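(* Let $f\in L^2(\mathbb P)$ have mean zero and satisfy $$\int_0^{+\infty}\left|\langle f,e^{-t\mathcal L}f\rangle\right|\,\mathrm dt<\infty .$$ Let $(\mu_k)_{k\in\mathbb N}$ be a sequence of real numbers in $(0,1]$, and define recursively $f_{-1}=f_{-1}^*:=f$ and, for every $k\in\mathbb N$, $$f_k:=\mu_k(\mu_k+\mathcal L)^{-1}f_{k-1},\qquad f_k^*:=\mu_k(\mu_k+\mathcal L^* )^{-1}f_{k-1}^* .$$ For every $n\in\mathbb N$, the quantity $$\langle f_n^*,\mathcal L^{-1}f_n\rangle:=\lim_{\lambda\to0^+}\langle f_n^*,(\lambda+\mathcal L)^{-1}f_n\rangle$$ is well-defined and finite, and $$\lim_{n\to\infty}\langle f_n^*,\mathcal L^{-1}f_n\rangle=0 .$$ Moreover, for every $n\in\mathbb N$, $$\langle f,\mathcal L^{-1}f\rangle=\sum_{k=0}^n\mu_k^{-1}\left(\langle f_{k-1}^*,f_k\rangle+\langle f_k^*,f_k\rangle\right)+\langle f_n^*,\mathcal L^{-1}f_n\rangle ,$$ where $\langle f,\mathcal L^{-1}f\rangle:=\lim_{\lambda\to0^+}\langle f,(\lambda+\mathcal L)^{-1}f\rangle$.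
   Context: $\mathbb N=\{0,1,2,\dots\}$. $(X(t))_{t\ge0}$ is a Feller process on a metric space $\mathcal X$ with expectations $(\mathbf E_x)_{x\in\mathcal X}$. $\mathbb P$ is a probability measure on $\mathcal X$ (expectation $\mathbb E$) which is invariant for the process; reversibility is not assumed. $\langle f,g\rangle:=\mathbb E[fg]$. $\mathcal L$ is the infinitesimal generator with the sign convention that $(e^{-t\mathcal L})_{t\ge0}$ is the semigroup: $(e^{-t\mathcal L}f)(x)=\mathbf E_x[f(X(t))]$, a contraction on $L^2(\mathbb P)$. For $\lambda>0$, $(\lambda+\mathcal L)^{-1}=\int_0^\infty e^{-\lambda t}e^{-t\mathcal L}\,\mathrm dt$. $\mathcal L^*$ is the adjoint of $\mathcal L$ in $L^2(\mathbb P)$, with semigroup $e^{-t\mathcal L^*}=(e^{-t\mathcal L})^*$ and resolvent $(\lambda+\mathcal L^* )^{-1}=((\lambda+\mathcal L)^{-1})^*$. *)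

(* Defs.v *)
From HB Require Import structures.
From mathcomp Require Import all_boot all_order all_algebra.
From mathcomp Require Import all_classical all_reals all_analysis measurable_realfun.

Set Implicit Arguments.
Unset Strict Implicit.
Unset Printing Implicit Defensive.

Import Order.TTheory GRing.Theory Num.Theory.
Import numFieldNormedType.Exports.

Local Open Scope classical_set_scope.
Local Open Scope ring_scope.

(* measurableType requires a point; a space carrying a probability measure is
   nonempty, so this is no restriction. *)
#[short(type="pmetricType")]
HB.structure Definition PointedMetric (R : numDomainType) :=
  { T of Metric R T & Pointed T }.

Notation borel T := (g_sigma_algebraType (@open T)).

Section FellerProcess.
Context (R : realType) (T : pmetricType R).
Context (d : measure_display) (Omega : measurableType d).
Context (X : R -> Omega -> borel T) (Pr : borel T -> probability Omega R).

(* Times are nonnegative reals: X t is never used for t < 0. *)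

(* Generators of the natural filtration at time s. *)
Definition past (s : R) : set (set Omega) :=
  [set A | exists (r : R) (B : set (borel T)),
     [/\ 0 <= r <= s, measurable B & A = X r @^-1` B]].

Definition semigroup (t : R) (f : T -> R) (x : T) : R :=
  fine 'E_(Pr x)[fun w => f (X t w)].

(* On a general metric space the Feller property is taken on bounded
   continuous functions; the continuity in time at 0 is the pointwise one,
   which follows from right-continuity of the paths. *)
Record feller_process : Prop := {
  feller_measurable : forall t, 0 <= t -> measurable_fun setT (X t);
  feller_kernel : forall A, measurable A -> measurable_fun setT (Pr ^~ A);
  feller_start : forall x : T, Pr x (X 0 @^-1` [set x]) = 1%E;
  feller_markov : forall (s t : R) (x : T) (A : set Omega) (B : set (borel T)),
    0 <= s -> 0 <= t -> <<s past s >> A -> measurable B ->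
    Pr x (A `&` X (s + t) @^-1` B) =
      (\int[Pr x]_(w in A) Pr (X s w) (X t @^-1` B))%E;
  feller_continuous : forall (t : R) (g : T -> R),
    0 <= t -> continuous g -> bounded_fun g -> continuous (semigroup t g);
  feller_cvg0 : forall (g : T -> R) (x : T),
    continuous g -> bounded_fun g -> semigroup t g x @[t --> 0^'+] --> g x
}.

Definition invariant_law (P : probability (borel T) R) : Prop :=
  forall (t : R) (B : set (borel T)), 0 <= t -> measurable B ->
    (\int[P]_x Pr x (X t @^-1` B))%E = P B.

Context (P : probability (borel T) R).

(* Elements of L^2(P) are handled through their representatives, the functions
   in Lfun P 2; operators below are determined up to P-a.e. equality. *)

Definition inner (f g : T -> R) : R := fine 'E_P[fun x => f x * g x].

(* The element h of L^2(P) such that <phi, h> = ell phi for all phi in L^2(P);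
   it exists when ell is a bounded linear functional. *)
Definition represent (ell : (T -> R) -> R) : T -> R :=
  xget (cst 0) [set h : T -> R | h \in Lfun P 2%:E /\
    forall phi : T -> R, phi \in Lfun P 2%:E -> inner phi h = ell phi].

(* (lambda + L)^-1 g = \int_0^oo e^(- lambda t) e^(- t L) g dt, as an integral
   with values in L^2(P), in the weak sense. *)
Definition resolvent (lambda : R) (g : T -> R) : T -> R :=
  represent (fun phi => \int[lebesgue_measure]_(t in `[0, +oo[)
    (expR (- (lambda * t)) * inner phi (semigroup t g))).

Definition L2adjoint (A : (T -> R) -> (T -> R)) (g : T -> R) : T -> R :=
  represent (fun phi => inner g (A phi)).

(* (lambda + L^* )^-1 = ((lambda + L)^-1)^* *)
Definition resolvent_adj (lambda : R) : (T -> R) -> (T -> R) :=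
  L2adjoint (resolvent lambda).

(* Indices are shifted by one: fseq f mu k is f_(k-1), so that fseq f mu 0 is
   f_(-1) = f and fseq f mu n.+1 is f_n; likewise for fseq_adj and f_k^*. *)
Fixpoint fseq (f : T -> R) (mu : nat -> R) (k : nat) : T -> R :=
  if k is n.+1 then (fun x => mu n * resolvent (mu n) (fseq f mu n) x) else f.

Fixpoint fseq_adj (f : T -> R) (mu : nat -> R) (k : nat) : T -> R :=
  if k is n.+1 then (fun x => mu n * resolvent_adj (mu n) (fseq_adj f mu n) x)
  else f.

(* <g, L^-1 h> is the limit at 0^+ of lambda |-> <g, (lambda + L)^-1 h>;
   inv_form is meaningful when inv_form_defined holds. *)
Definition inv_form_defined (g h : T -> R) : Prop :=
  cvg (inner g (resolvent lambda h) @[lambda --> 0^'+]).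

Definition inv_form (g h : T -> R) : R :=
  lim (inner g (resolvent lambda h) @[lambda --> 0^'+]).

End FellerProcess.

(* Main.v *)
Require Import Defs.
From HB Require Import structures.
From mathcomp Require Import all_boot all_order all_algebra.
From mathcomp Require Import all_classical all_reals all_analysis measurable_realfun.
From mathcomp Require Import ring lra.

Set Implicit Arguments.
Unset Strict Implicit.
Unset Printing Implicit Defensive.

Import Order.TTheory GRing.Theory Num.Theory.
Import numFieldNormedType.Exports.

Local Open Scope classical_set_scope.
Local Open Scope ring_scope.

(** Write [S_t] for the semigroup, [G_l] for the resolvent and C(t) for
    <f, S_t f>.  The quantity <f_n^*, G_l f_n> is the Laplace transform at [l]
    of C_n(t) = <f_n^*, S_t f_n>.  Passing from f_(k-1) to f_k, and from
    f_(k-1)^* to f_k^*, replaces C by its average over an exponential shift of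
    rate mu_k, so that C_n(t) is the mean of C(t + tau_n), where tau_n is a sum
    of 2n + 2 independent exponential times of mean at least one (f_0 already
    carries two of them).

    Dominated convergence gives the limit at 0 of the Laplace transform of C.
    Moving the average from C to the weight bounds the Laplace transform of
    C_n, uniformly in l, by the integral of P(tau_n <= t) |C(t)|.  As tau_n
    tends to infinity, this vanishes, by dominated convergence again.  Instead
    of the law of tau_n only its Chernoff bound min(1, 2^-j e^t) is used, with
    j at most the number of exponential times: it is the weight [damp], it
    loses a factor two at each average ([damp_conv], [damp_average]), and
    [damp_cvg0] concludes.

    The identity is purely algebraic for l > 0: the resolvent equation, used
    once on each side of the scalar product, expresses <f_(k-1)^*, G_l f_(k-1)>
    in terms of <f_k^*, G_l f_k> ([two_resolvent_equations]).  Its limit as l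
    tends to 0 is one term of the telescoping sum, and it also carries the
    existence of the limit from one index to the next.

    What precedes needs operators on L^2(P) that are only given through weak
    formulas.  Their existence is the Riesz theorem ([represent_spec]).  Their
    Laplace transforms make sense because t |-> <g, S_t f> is measurable
    ([measurable_correlation]), which comes from the Feller property through
    the approximation of open sets by continuous functions.  The resolvent
    equation is Fubini's theorem applied to the correlation function
    ([resolvent_average]). *)

(** * The scalar product of L^2(P) *)

Lemma cvg_sqr_le (R : realType) (u v : nat -> R) (l M : R) :
  (forall n, (u n - l) ^+ 2 <= M * v n) ->
  v n @[n --> \oo] --> 0 -> u n @[n --> \oo] --> l.
Proof.
move=> uv v0; apply/cvgrPdist_le => e e0.
have M1 : 0 < 1 + `|M| by rewrite ltr_wpDr.
move/cvgrPdist_le : v0 => /(_ (e ^+ 2 / (1 + `|M|))).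
rewrite divr_gt0 ?exprn_gt0// => /(_ isT); apply: filterS => n /=.
rewrite sub0r normrN ler_pdivlMr// => vn.
rewrite distrC -ler_sqr ?nnegrE ?(ltW e0)// real_normK ?num_real//.
apply: (le_trans (uv n)); apply: le_trans vn.
rewrite (le_trans (ler_norm _))// normrM mulrC ler_wpM2l// lerDr ler01//.
Qed.

Lemma L2P (R : realType) d (X : measurableType d)
    (P : {measure set X -> \bar R}) (f : X -> R) : f \in Lfun P 2%:E <->
  measurable_fun [set: X] f /\
  P.-integrable [set: X] (EFin \o (fun x => f x ^+ 2)).
Proof.
split=> [fL2|[mf if2]].
  by split; [move/sub_Lfun_mfun: fL2; rewrite inE|exact: Lfun2_integrable_sqr].
rewrite inE; apply/andP; split; rewrite inE //= /finite_norm unlock.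
rewrite poweR_lty//; case/integrableP: if2 => _; apply: le_lt_trans.
apply: ge0_le_integral => //=.
- apply/measurable_EFinP.
  apply: (@measurableT_comp _ _ _ _ _ _ (fun x : R => x `^ 2)%R) => //.
  exact/measurableT_comp.
- do 2 apply: measurableT_comp => //.
  by apply: measurable_funX.
- by move=> x _; rewrite powR_mulrn// -normrX lee_fin.
Qed.

Section L2_space.
Context (R : realType) (T : pmetricType R).
Implicit Types (P : probability (borel T) R) (f g h : T -> R).

Lemma inner_Rintegral P f g :
  inner P f g = \int[P]_(x in [set: borel T]) (f x * g x).
Proof. by rewrite /inner expectation.unlock. Qed.

Lemma L2_measurable P f : f \in Lfun P 2%:E -> measurable_fun [set: borel T] f.
Proof. by case/L2P. Qed.

Lemma L2_ge0_le P f (g : T -> R) : measurable_fun [set: borel T] f ->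
  P.-integrable [set: borel T] (EFin \o g) -> (forall x, f x ^+ 2 <= g x) ->
  f \in Lfun P 2%:E.
Proof.
move=> mf ig fg; apply/L2P; split => //.
apply: le_integrable ig => //=.
  by apply/measurable_EFinP; exact: measurable_funX.
move=> x _; rewrite lee_fin ger0_norm ?sqr_ge0//.
by rewrite (le_trans (fg x))// ler_norm.
Qed.

Lemma L2_bounded P f (M : R) : measurable_fun [set: borel T] f ->
  (forall x, `|f x| <= M) -> f \in Lfun P 2%:E.
Proof.
move=> mf fM; apply: (@L2_ge0_le _ _ (cst (M ^+ 2))) => // [|x].
  exact: finite_measure_integrable_cst.
by rewrite -real_normK ?num_real// lerXn2r// nnegrE// (le_trans _ (fM x)).
Qed.

Lemma L2_lin P (a : R) f g : f \in Lfun P 2%:E -> g \in Lfun P 2%:E ->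
  (fun x => a * f x + g x) \in Lfun P 2%:E.
Proof.
move=> /L2P[mf if2] /L2P[mg ig2].
apply: (@L2_ge0_le _ _ (fun x => 2 * a ^+ 2 * f x ^+ 2 + 2 * g x ^+ 2)) => [||x].
- by apply: measurable_funD => //; exact: measurable_funM.
- exact: (integrableD measurableT
    (integrableZl measurableT (2 * a ^+ 2) if2) (integrableZl measurableT 2 ig2)).
- have := sqr_ge0 (a * f x - g x); rewrite sqrrB sqrrD exprMn; lra.
Qed.

Lemma L2_cst P (a : R) : (fun=> a) \in Lfun P 2%:E.
Proof. by apply: (@L2_bounded _ _ `|a|). Qed.

Lemma L2Z P (a : R) f : f \in Lfun P 2%:E -> (fun x => a * f x) \in Lfun P 2%:E.
Proof.
move=> fL; rewrite (_ : (fun x => a * f x) = (fun x => a * f x + 0)).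
  by apply: L2_lin => //; exact: L2_cst.
by apply/funext => x; rewrite addr0.
Qed.

Lemma L2B P f g : f \in Lfun P 2%:E -> g \in Lfun P 2%:E ->
  (fun x => f x - g x) \in Lfun P 2%:E.
Proof.
move=> fL gL; rewrite (_ : (fun x => f x - g x) = (fun x => -1 * g x + f x)).
  exact: L2_lin.
by apply/funext => x; rewrite mulN1r addrC.
Qed.

Lemma L2_integrableM P f g : f \in Lfun P 2%:E -> g \in Lfun P 2%:E ->
  P.-integrable [set: borel T] (EFin \o (fun x => f x * g x)).
Proof. by move=> fL gL; apply/Lfun1_integrable; exact: Lfun2_mul_Lfun1. Qed.

Lemma innerC P f g : inner P f g = inner P g f.
Proof. by rewrite /inner; congr (fine 'E_P[_]); apply/funext => x; rewrite mulrC. Qed.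

Lemma inner_linr P (a : R) h f g : h \in Lfun P 2%:E ->
  f \in Lfun P 2%:E -> g \in Lfun P 2%:E ->
  inner P h (fun x => a * f x + g x) = a * inner P h f + inner P h g.
Proof.
move=> hL fL gL; rewrite !inner_Rintegral.
under eq_Rintegral do rewrite mulrDr mulrCA.
rewrite RintegralD//; last 2 first.
- exact: (integrableZl measurableT _ (L2_integrableM hL fL)).
- exact: L2_integrableM.
by rewrite RintegralZl//; exact: L2_integrableM.
Qed.

Lemma innerZr P (a : R) h f : h \in Lfun P 2%:E -> f \in Lfun P 2%:E ->
  inner P h (fun x => a * f x) = a * inner P h f.
Proof.
move=> hL fL; rewrite !inner_Rintegral -RintegralZl//; last exact: L2_integrableM.
by apply: eq_Rintegral => x _; rewrite mulrCA.
Qed.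

Lemma innerBr P h f g : h \in Lfun P 2%:E ->
  f \in Lfun P 2%:E -> g \in Lfun P 2%:E ->
  inner P h (fun x => f x - g x) = inner P h f - inner P h g.
Proof.
move=> hL fL gL.
rewrite -(_ : (fun x => -1 * g x + f x) = (fun x => f x - g x)); last first.
  by apply/funext => x; rewrite mulN1r addrC.
by rewrite inner_linr// mulN1r addrC.
Qed.

Lemma innerZl P (a : R) h f : h \in Lfun P 2%:E -> f \in Lfun P 2%:E ->
  inner P (fun x => a * h x) f = a * inner P h f.
Proof. by move=> hL fL; rewrite innerC innerZr// innerC. Qed.

Lemma inner_ge0 P f : 0 <= inner P f f.
Proof.
by rewrite inner_Rintegral; apply: Rintegral_ge0 => x _; rewrite -expr2 sqr_ge0.
Qed.

Lemma inner_CauchySchwarz P f g : f \in Lfun P 2%:E -> g \in Lfun P 2%:E ->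
  inner P f g ^+ 2 <= inner P f f * inner P g g.
Proof.
move=> fL gL.
have quad a : 0 <= a ^+ 2 * inner P f f + 2 * a * inner P f g + inner P g g.
  have := inner_ge0 P (fun x => a * f x + g x).
  rewrite inner_linr//; last exact: L2_lin.
  rewrite innerC inner_linr// [X in _ + X]innerC inner_linr// (innerC _ g f).
  lra.
have := inner_ge0 P f; rewrite le_eqVlt => /predU1P[f0|f0].
  (* A nonconstant affine function of a takes negative values. *)
  suff -> : inner P f g = 0 by rewrite -f0 expr0n mul0r.
  apply/eqP/negPn/negP => fg0.
  have := quad (- (inner P g g + 1) / (2 * inner P f g)); rewrite -f0 mulr0 add0r.
  have -> : 2 * (- (inner P g g + 1) / (2 * inner P f g)) * inner P f g =
     - (inner P g g + 1) by field.
  lra.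
(* The minimum of the quadratic. *)
have := quad (- inner P f g / inner P f f).
have -> : (- inner P f g / inner P f f) ^+ 2 * inner P f f +
    2 * (- inner P f g / inner P f f) * inner P f g + inner P g g =
   (inner P f f * inner P g g - inner P f g ^+ 2) / inner P f f.
  by field; rewrite gt_eqF.
by rewrite pmulr_lge0 ?invr_gt0// subr_ge0.
Qed.

Lemma inner_cvgr P h f (f_ : nat -> T -> R) : h \in Lfun P 2%:E ->
  f \in Lfun P 2%:E -> (forall n, f_ n \in Lfun P 2%:E) ->
  inner P (fun x => f_ n x - f x) (fun x => f_ n x - f x) @[n --> \oo] --> 0 ->
  inner P h (f_ n) @[n --> \oo] --> inner P h f.
Proof.
move=> hL fL f_L; apply: cvg_sqr_le => n; rewrite -innerBr//.
by apply: inner_CauchySchwarz => //; exact: L2B.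
Qed.

(** Pointwise convergence under a square integrable bound is convergence in
    mean square, the form in which dominated convergence is used below. *)
Lemma L2_dominated_cvg P (f : T -> R) (f_ : nat -> T -> R) (G : T -> R) :
  (forall n, measurable_fun [set: borel T] (f_ n)) -> f \in Lfun P 2%:E ->
  P.-integrable [set: borel T] (EFin \o G) ->
  (forall n x, (f_ n x - f x) ^+ 2 <= G x) ->
  (forall x, f_ n x @[n --> \oo] --> f x) ->
  inner P (fun x => f_ n x - f x) (fun x => f_ n x - f x) @[n --> \oo] --> 0.
Proof.
move=> mf_ fL iG f_G f_f.
have mf := L2_measurable fL.
have := @dominated_cvg _ _ _ P _ (@measurableT _ (borel T))
  (fun n x => ((f_ n x - f x) ^+ 2)%:E) (cst 0%E) (EFin \o G).
rewrite integral0 => H.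
rewrite [X in X @ _ --> _](_ : _ =
   (fun n => fine (\int[P]_(x in [set: borel T]) ((f_ n x - f x) ^+ 2)%:E)%E)); last first.
  apply/funext => n; rewrite inner_Rintegral /Rintegral; congr fine.
apply: fine_cvg => /=; apply: H => //.
- move=> n; apply/measurable_EFinP/measurable_funX.
  exact: measurable_funB.
- move=> x _; apply: cvg_EFin; first exact: nearW.
  rewrite [X in _ --> X](_ : _ = (f x - f x) ^+ 2); last by rewrite subrr expr0n.
  rewrite expr2.
  by apply: cvgM; apply: cvgB; (exact: f_f || exact: cvg_cst).
- by move=> n x _; rewrite /= lee_fin ger0_norm ?sqr_ge0// f_G.
Qed.

End L2_space.

(** * Density of simple functions *)

Section L2_density.
Import HBNNSimple.
Context (R : realType) (T : pmetricType R).
Implicit Types (P : probability (borel T) R) (f g h : T -> R).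

Lemma indic_itv01 (A : set T) x : 0 <= (\1_A x : R) <= 1.
Proof. by rewrite indicE; case: (x \in A); rewrite /= ?lexx ler01. Qed.

Lemma L2_indic P (A : set (borel T)) : measurable A ->
  (\1_A : T -> R) \in Lfun P 2%:E.
Proof.
move=> mA; apply: (@L2_bounded _ _ _ _ 1) => [|x]; first exact: measurable_indic.
by have /andP[? ?] := indic_itv01 A x; rewrite ger0_norm.
Qed.

Lemma L2_indicM P f (A : set (borel T)) : f \in Lfun P 2%:E -> measurable A ->
  (fun x => f x * \1_A x) \in Lfun P 2%:E.
Proof.
move=> /L2P[mf if2] mA; apply: (@L2_ge0_le _ _ _ _ (fun x => f x ^+ 2)) => // [|x].
  by apply: measurable_funM => //; exact: measurable_indic.
have /andP[a0 a1] := indic_itv01 A x.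
by rewrite exprMn ler_piMr ?sqr_ge0// exprn_ile1.
Qed.

Lemma L2_sum_indic P (F : nat -> set (borel T)) n :
  (forall i, measurable (F i)) ->
  (fun x => \sum_(i < n) (\1_(F i) x : R)) \in Lfun P 2%:E.
Proof.
move=> mF; elim: n => [|n IH].
  rewrite (_ : (fun _ => _) = fun=> 0); first exact: L2_cst.
  by apply/funext => x; rewrite big_ord0.
rewrite (_ : (fun x => _) =
    (fun x => 1 * \sum_(i < n) (\1_(F i) x : R) + \1_(F n) x)); last first.
  by apply/funext => x; rewrite big_ord_recr/= mul1r.
by apply: L2_lin => //; exact: L2_indic.
Qed.

(** Evaluated at a point x, this is the countable additivity of the Dirac mass at
    x; the partial sums stay between 0 and 1 because the sets are disjoint. *)
Lemma L2_sum_indic_cvg P (F : nat -> set (borel T)) :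
  (forall i, measurable (F i)) -> trivIset setT F ->
  let f_ n (x : T) := \sum_(i < n) (\1_(F i) x : R) in
  let f := \1_(\bigcup_n F n) in
  inner P (fun x => f_ n x - f x) (fun x => f_ n x - f x) @[n --> \oo] --> 0.
Proof.
move=> mF tF f_ f.
have mUF : measurable (\bigcup_n F n) by exact: bigcup_measurable.
have f_E n x : (f_ n x)%:E = dirac (x : borel T) (\big[setU/set0]_(i < n) F i).
  by rewrite (measure_bigsetU _ mF tF)// /f_ -sumEFin; apply: eq_bigr.
apply: (@L2_dominated_cvg _ _ _ _ _ (cst 1)).
- by move=> n; exact: L2_measurable (L2_sum_indic P n mF).
- exact: L2_indic.
- exact: finite_measure_integrable_cst.
- move=> n x; have [-> /andP[a0 a1]] : f_ n x = \1_(\big[setU/set0]_(i < n) F i) x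
      /\ 0 <= (\1_(\big[setU/set0]_(i < n) F i) x : R) <= 1.
    by split; [have [] := f_E n x|exact: indic_itv01].
  have /andP[b0 b1] := indic_itv01 (\bigcup_n F n) x.
  rewrite /f /=; set a := \1_(\big[_/_]_(i < _) _) _ in a0 a1 *.
  by set b := \1__ _ in b0 b1 *; nra.
- move=> x; have := @measure_semi_sigma_additive _ _ _
    (@dirac _ (borel T) x R) F mF tF mUF.
  rewrite /dirac => /fine_cvg /=; apply: cvg_trans; apply: near_eq_cvg.
  by near=> n; rewrite /= sumEFin /= big_mkord.
Unshelve. all: by end_near. Qed.

Lemma le_nnsfun_approx (f : T -> R) (mf : measurable_fun [set: borel T] (EFin \o f)) :
  (forall x, 0 <= f x) ->
  forall x, (forall n, nnsfun_approx measurableT mf n x <= f x) /\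
    nnsfun_approx measurableT mf n x @[n --> \oo] --> f x.
Proof.
move=> f0 x.
have c : nnsfun_approx measurableT mf n x @[n --> \oo] --> f x.
  have := @cvg_nnsfun_approx _ _ _ _ measurableT _ mf _ x I.
  move=> /(_ _)/fine_cvg; apply.
  by move=> y _; rewrite /= lee_fin.
split => // n; rewrite -(cvg_lim _ c)//; apply: nondecreasing_cvgn_le.
  by move=> a b ab; exact/lefP/nd_nnsfun_approx.
by apply/cvg_ex; exists (f x).
Qed.

(** An induction principle: simple functions are combinations of indicators, a
    nonnegative function is an increasing limit of simple ones, and a general
    one is the difference of its positive and negative parts. *)
Lemma L2_ind P (Q : (T -> R) -> Prop) :
  (forall A, measurable (A : set (borel T)) -> Q (\1_A)) ->
  (forall a f g, f \in Lfun P 2%:E -> g \in Lfun P 2%:E -> Q f -> Q g ->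
    Q (fun x => a * f x + g x)) ->
  (forall f (f_ : nat -> T -> R), f \in Lfun P 2%:E ->
    (forall n, f_ n \in Lfun P 2%:E) ->
    inner P (fun x => f_ n x - f x) (fun x => f_ n x - f x) @[n --> \oo] --> 0 ->
    (forall n, Q (f_ n)) -> Q f) ->
  forall f, f \in Lfun P 2%:E -> Q f.
Proof.
move=> Qindic Qlin Qlim.
have Qsum (s : seq R) (A : R -> set (borel T)) : (forall r, measurable (A r)) ->
    let g := fun x => \sum_(r <- s) (r * \1_(A r) x) in g \in Lfun P 2%:E /\ Q g.
  move=> mA; elim: s => [|r s [gL Qg]] /=.
    rewrite (_ : (fun _ => _) = \1_set0); last first.
      by apply/funext => x; rewrite big_nil indic0.
    by split; [exact: L2_indic|exact: Qindic].
  rewrite (_ : (fun _ => _) =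
      (fun x => r * \1_(A r) x + \sum_(r <- s) (r * \1_(A r) x))); last first.
    by apply/funext => x; rewrite big_cons.
  split; first by apply: L2_lin => //; exact: L2_indic.
  by apply: Qlin => //; [exact: L2_indic|exact: Qindic].
have Qsfun (h : {nnsfun borel T >-> R}) : (h : T -> R) \in Lfun P 2%:E /\ Q h.
  have -> : (h : T -> R) = (fun x => \sum_(r <- finmap.enum_fset (fset_set (range h)))
      (r * \1_(h @^-1` [set r]) x)).
    by apply/funext => x; rewrite fimfunE fsbig_finite.
  by apply: (Qsum _ (fun r => h @^-1` [set r])).
have Qnneg f : f \in Lfun P 2%:E -> (forall x, 0 <= f x) -> Q f.
  move=> fL f0; have /L2P[mf if2] := fL.
  have mEf : measurable_fun [set: borel T] (EFin \o f) by exact/measurable_EFinP.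
  have H := le_nnsfun_approx mEf f0.
  apply: (Qlim _ (fun n => nnsfun_approx measurableT mEf n : T -> R)) => // [n||n].
  - by have [] := Qsfun (nnsfun_approx measurableT mEf n).
  - apply: (@L2_dominated_cvg _ _ _ _ _ (fun x => f x ^+ 2)) => // [n x|x].
      have [le_f _] := H x; have a0 : 0 <= nnsfun_approx measurableT mEf n x by [].
      have := le_f n; nra.
    by have [] := H x.
  - by have [] := Qsfun (nnsfun_approx measurableT mEf n).
move=> f fL; have /L2P[mf if2] := fL.
have mposL (g : T -> R) : measurable_fun [set: borel T] g ->
    (forall x, g x ^+ 2 <= f x ^+ 2) -> g \in Lfun P 2%:E.
  by move=> mg gf; exact: (L2_ge0_le mg if2).
have fpL : (fun x => Num.max (f x) 0) \in Lfun P 2%:E.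
  apply: mposL => [|x]; first exact: measurable_maxr.
  by case: (leP (f x) 0) => _; rewrite ?expr0n ?lexx ?sqr_ge0.
have fnL : (fun x => Num.max (- f x) 0) \in Lfun P 2%:E.
  apply: mposL => [|x]; first by apply: measurable_maxr => //; exact: measurableT_comp.
  by case: (leP (- f x) 0) => _; rewrite ?sqrrN ?expr0n ?lexx ?sqr_ge0.
rewrite (_ : f = fun x => -1 * Num.max (- f x) 0 + Num.max (f x) 0).
  by apply: Qlin => //; apply: Qnneg => // x; rewrite le_max lexx orbT.
by apply/funext => x; case: (leP (f x) 0); case: (leP (- f x) 0); lra.
Qed.

End L2_density.

(** * Riesz representation *)

Section Riesz.
Context (R : realType) (T : pmetricType R) (P : probability (borel T) R).
Variables (ell : (T -> R) -> R) (M : R).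
Hypothesis ell_lin : forall a f g, f \in Lfun P 2%:E -> g \in Lfun P 2%:E ->
  ell (fun x => a * f x + g x) = a * ell f + ell g.
Hypothesis ell_bounded : forall f, f \in Lfun P 2%:E ->
  ell f ^+ 2 <= M * inner P f f.

Let ell_cvg f (f_ : nat -> T -> R) : f \in Lfun P 2%:E ->
  (forall n, f_ n \in Lfun P 2%:E) ->
  inner P (fun x => f_ n x - f x) (fun x => f_ n x - f x) @[n --> \oo] --> 0 ->
  ell (f_ n) @[n --> \oo] --> ell f.
Proof.
move=> fL f_L; apply: cvg_sqr_le => n; apply: le_trans (ell_bounded (L2B (f_L n) fL)).
rewrite (_ : (fun x => f_ n x - f x) = (fun x => -1 * f x + f_ n x)); last first.
  by apply/funext => x; rewrite mulN1r addrC.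
by rewrite ell_lin// mulN1r addrC.
Qed.

Let ell0 f : f \in Lfun P 2%:E -> inner P f f = 0 -> ell f = 0.
Proof.
move=> fL f0; have := ell_bounded fL; rewrite f0 mulr0 => h.
by apply/eqP; rewrite -sqrf_eq0 eq_le h sqr_ge0.
Qed.

Let inner_indic (A : set (borel T)) : measurable A ->
  inner P \1_A \1_A = fine (P A).
Proof.
move=> mA; rewrite inner_Rintegral /Rintegral; congr fine.
rewrite -[A in RHS]setIT -integral_indic//; apply: eq_integral => x _.
by rewrite indicE; case: (x \in A); rewrite ?mulr1 ?mulr0.
Qed.

(** A charge dominated by [P]: its density is the vector that represents
    [ell]. *)
Let nu (A : set (borel T)) : \bar R := (ell \1_A)%:E.

Let nuE A : nu A = (ell \1_A)%:E.
Proof. by []. Qed.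

Let nu0 : nu set0 = 0%E.
Proof.
rewrite nuE// ell0//; first exact: L2_indic.
by rewrite inner_indic// measure0.
Qed.

Let nu_fin A : measurable A -> nu A \is a fin_num.
Proof. by move=> mA; rewrite nuE. Qed.

Let ell_sum (F : nat -> set (borel T)) n : (forall i, measurable (F i)) ->
  ell (fun x => \sum_(i < n) (\1_(F i) x : R)) = \sum_(i < n) ell (\1_(F i)).
Proof.
move=> mF; elim: n => [|n IH].
  rewrite big_ord0 (_ : (fun _ => _) = \1_set0).
    by apply: EFin_inj; rewrite -nuE.
  by apply/funext => x; rewrite big_ord0 indic0.
rewrite big_ord_recr/= -IH (_ : (fun x => _) =
    (fun x => 1 * \sum_(i < n) (\1_(F i) x : R) + \1_(F n) x)); last first.
  by apply/funext => x; rewrite big_ord_recr/= mul1r.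
by rewrite ell_lin ?mul1r//; [exact: L2_sum_indic|exact: L2_indic].
Qed.

Let nu_sigma_additive : semi_sigma_additive nu.
Proof.
move=> F mF tF mUF; rewrite nuE//.
apply: cvg_EFin.
  near=> n; rewrite sum_fin_num; apply/allP => /= y /mapP[i _ ->].
  exact: nu_fin.
have := ell_cvg (L2_indic P mUF) (fun n => L2_sum_indic P n mF) (L2_sum_indic_cvg P mF tF).
apply: cvg_trans; apply: near_eq_cvg; near=> n.
rewrite ell_sum//= big_mkord.
under [X in _ = fine X]eq_bigr do rewrite nuE//.
by rewrite sumEFin.
Unshelve. all: by end_near. Qed.

HB.instance Definition _ := isCharge.Build _ _ _ nu nu0 nu_fin nu_sigma_additive.

Let nu_dominated : nu `<< P.
Proof.
apply/null_content_dominatesP => A mA PA; rewrite nuE// ell0//; first exact: L2_indic.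
by rewrite inner_indic// PA.
Qed.

Let h (x : T) : R := fine (Radon_Nikodym nu P x).

Let h_integrable : P.-integrable [set: borel T] (EFin \o h).
Proof.
have := Radon_Nikodym_integrable nu_dominated; apply: eq_integrable => // x _.
by rewrite /= /h fineK// Radon_Nikodym_fin_num.
Qed.

Let measurable_h : measurable_fun [set: borel T] h.
Proof. by apply/measurable_EFinP; case/integrableP: h_integrable. Qed.

Let inner_indic_h (A : set (borel T)) : measurable A -> inner P \1_A h = ell \1_A.
Proof.
move=> mA; apply: EFin_inj; rewrite -nuE// inner_Rintegral /Rintegral.
rewrite [X in fine X](_ : _ = nu A) ?fineK ?nu_fin//.
rewrite (Radon_Nikodym_integral nu_dominated)//.
rewrite [RHS]integral_mkcond; apply: eq_integral => x _.
rewrite epatch_indic /= EFinM muleC; congr (_ * _)%E.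
by rewrite /h fineK// Radon_Nikodym_fin_num.
Qed.

(** The density is a priori only integrable.  Its truncation to a level set is
    bounded, hence in L^2, and represents [ell] on that level set. *)
Let level (n : nat) : set (borel T) := [set x | `|h x| <= n%:R].

Let measurable_level n : measurable (level n).
Proof.
have -> : level n = [set: borel T] `&` (fun x => `|h x|) @^-1` `]-oo, n%:R].
  by apply/seteqP; split => x /=; rewrite in_itv/=; [split|case].
by apply: (measurableT_comp _ measurable_h).
Qed.

Let h_ n (x : T) := h x * \1_(level n) x.

Let h_L2 n : h_ n \in Lfun P 2%:E.
Proof.
apply: (@L2_bounded _ _ _ _ n%:R) => [|x].
  by apply: measurable_funM => //; exact: measurable_indic.
rewrite /h_ indicE; have [/set_mem|] := boolP (x \in level n); rewrite ?mulr1//.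
by rewrite mulr0 normr0.
Qed.

Let indicM_cvg (A : set (borel T)) f (f_ : nat -> T -> R) : measurable A ->
  f \in Lfun P 2%:E -> (forall n, f_ n \in Lfun P 2%:E) ->
  inner P (fun x => f_ n x - f x) (fun x => f_ n x - f x) @[n --> \oo] --> 0 ->
  let g_ n x := f_ n x * \1_A x in let g x := f x * \1_A x in
  inner P (fun x => g_ n x - g x) (fun x => g_ n x - g x) @[n --> \oo] --> 0.
Proof.
move=> mA fL f_L f_f g_ g; apply: squeeze_cvgr f_f; last exact: cvg_cst.
apply: nearW => n; rewrite inner_ge0/= !inner_Rintegral.
have gL : (fun x => g_ n x - g x) \in Lfun P 2%:E by apply: L2B; exact: L2_indicM.
have fnL := L2B (f_L n) fL.
apply: le_Rintegral => //; [exact: L2_integrableM|exact: L2_integrableM|].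
move=> x _; rewrite /g_ /g -mulrBl -!expr2 exprMn ler_piMr ?sqr_ge0//.
Qed.

Let inner_h_ n f : f \in Lfun P 2%:E ->
  inner P f (h_ n) = ell (fun x => f x * \1_(level n) x).
Proof.
move: f.
apply: (@L2_ind _ _ P (fun f =>
    inner P f (h_ n) = ell (fun x => f x * \1_(level n) x))) =>
  [A mA|a f g fL gL ef eg|f f_ fL f_L f_f ef].
- have -> : (fun x => \1_A x * \1_(level n) x) = \1_(A `&` level n) :> (T -> R).
    by rewrite indicI.
  rewrite -inner_indic_h; last exact: measurableI.
  rewrite indicI !inner_Rintegral; apply: eq_Rintegral => x _.
  by rewrite /h_ mulrCA mulrC.
- rewrite innerC inner_linr// innerC ef innerC eg -ell_lin; last 2 first.
    exact: L2_indicM.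
    exact: L2_indicM.
  by congr ell; apply/funext => x; rewrite mulrDl mulrA.
- have c1 := inner_cvgr (h_L2 n) fL f_L f_f.
  have c2 := ell_cvg (L2_indicM fL (measurable_level n))
    (fun k => L2_indicM (f_L k) (measurable_level n))
    (indicM_cvg (measurable_level n) fL f_L f_f).
  have e : (fun k => inner P (h_ n) (f_ k)) =
      (fun k => ell (fun x => f_ k x * \1_(level n) x)).
    by apply/funext => k; rewrite innerC ef.
  by rewrite innerC -(cvg_lim _ c1)// e; exact: cvg_lim.
Qed.

(** Testing [ell] on the truncation itself bounds its norm uniformly in [n];
    monotone convergence then puts the density in L^2. *)
Let h_norm_le n : inner P (h_ n) (h_ n) <= `|M|.
Proof.
have hh : inner P (h_ n) (h_ n) = ell (h_ n).
  rewrite inner_h_//; congr ell; apply/funext => x.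
  by rewrite /h_ indicE; case: (x \in _); rewrite ?mulr0 ?mulr1.
have := ell_bounded (h_L2 n); rewrite -hh.
have := inner_ge0 P (h_ n); rewrite le_eqVlt => /predU1P[<-//|h0].
by rewrite expr2 ler_pM2r// => /le_trans; apply; exact: ler_norm.
Qed.

Let hL2 : h \in Lfun P 2%:E.
Proof.
apply/L2P; split => //; apply/integrableP; split.
  by apply/measurable_EFinP; exact: measurable_funX.
have cvg_h x : (h_ n x ^+ 2)%:E @[n --> \oo] --> (h x ^+ 2)%:E.
  apply: cvg_near_cst; near=> n.
  rewrite /h_ indicE mem_set ?mulr1//.
  by near: n; exact: nbhs_infty_ger.
under eq_integral => x _ do
  rewrite /= ger0_norm ?sqr_ge0// -(cvg_lim _ (cvg_h x))//.
have mh_ n : measurable_fun [set: borel T] (fun x => (h_ n x ^+ 2)%:E).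
  by apply/measurable_EFinP/measurable_funX; exact: L2_measurable (h_L2 n).
have hnd x : {homo (fun n => (h_ n x ^+ 2)%:E) : n m / (n <= m)%N >-> (n <= m)%E}.
  move=> n m nm; rewrite lee_fin /h_ !indicE.
  have [/set_mem xn|_] := boolP (x \in level n); last first.
    by rewrite mulr0 expr0n sqr_ge0.
  by rewrite (mem_set (A := level m))// /level /=(le_trans xn)// ler_nat.
rewrite monotone_convergence//; last by move=> n x _; rewrite lee_fin sqr_ge0.
apply: (@le_lt_trans _ _ `|M|%:E); last exact: ltry.
apply: lime_le.
  apply: ereal_nondecreasing_is_cvgn => n m nm; apply: ge0_le_integral => //.
  - by move=> x _; rewrite lee_fin sqr_ge0.
  - by move=> x _; exact: hnd.
apply: nearW => n.
have := h_norm_le n; rewrite inner_Rintegral /Rintegral -lee_fin fineK//.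
by apply: integrable_fin_num => //; exact: L2_integrableM.
Unshelve. all: by end_near. Qed.

(** The density of [nu] agrees with [ell] on indicators, hence on L^2 by
    continuity; [represent] therefore selects a vector with its property. *)
Lemma represent_spec : represent P ell \in Lfun P 2%:E /\
  forall f, f \in Lfun P 2%:E -> inner P f (represent P ell) = ell f.
Proof.
pose S := [set g : T -> R | g \in Lfun P 2%:E /\
  forall f : T -> R, f \in Lfun P 2%:E -> inner P f g = ell f].
suff : S (xget (cst 0) S) by [].
apply: xgetPex; exists h; split => //.
apply: (@L2_ind _ _ P (fun f => inner P f h = ell f)) =>
  [A mA|a f g fL gL ef eg|f f_ fL f_L f_f ef].
- exact: inner_indic_h.
- by rewrite innerC inner_linr// innerC ef innerC eg ell_lin.
- have c1 := inner_cvgr hL2 fL f_L f_f; have c2 := ell_cvg fL f_L f_f.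
  have e : (fun k => inner P h (f_ k)) = (fun k => ell (f_ k)).
    by apply/funext => k; rewrite innerC ef.
  by rewrite innerC -(cvg_lim _ c1)// e; exact: cvg_lim.
Qed.

End Riesz.

(** * Averaging over a random starting point *)

Section mixture.
Context (R : realType) d d' (X : measurableType d) (Y : measurableType d').
Variables (P : probability X R) (k : X -> probability Y R).
Hypothesis mk : forall A, measurable A -> measurable_fun [set: X] (k ^~ A).

Let start (_ : unit) : {measure set X -> \bar R} := P.
Let measurable_start U : measurable U -> measurable_fun [set: unit] (start ^~ U).
Proof. by move=> mU; exact: measurable_cst. Qed.
HB.instance Definition _ := isKernel.Build _ _ _ _ _ start measurable_start.
Let start_prob x : start x [set: X] = 1%E.
Proof. exact: probability_setT. Qed.
HB.instance Definition _ := Kernel_isProbability.Build _ _ _ _ _ start start_prob.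

Let step (z : unit * X) : {measure set Y -> \bar R} := k z.2.
Let measurable_step U : measurable U ->
  measurable_fun [set: unit * X] (step ^~ U).
Proof.
move=> mU; apply: (measurableT_comp (mk mU)); exact: measurable_snd.
Qed.
HB.instance Definition _ := isKernel.Build _ _ _ _ _ step measurable_step.
Let step_prob x : step x [set: Y] = 1%E.
Proof. exact: probability_setT. Qed.
HB.instance Definition _ := Kernel_isProbability.Build _ _ _ _ _ step step_prob.

(** The law of [phi y], when x is drawn from [P] and then y from [k x], is the
    image of a composed kernel; so it is determined by its values on sets. *)
Lemma integral_mixture d2 (Z : measurableType d2) (m : {measure set Z -> \bar R})
    (phi : Y -> Z) (f : Z -> \bar R) :
  measurable_fun [set: Y] phi ->
  (forall B, measurable B -> (\int[P]_x k x (phi @^-1` B))%E = m B) ->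
  (forall z, (0 <= f z)%E) -> measurable_fun [set: Z] f ->
  (\int[P]_x \int[k x]_y f (phi y) = \int[m]_z f z)%E.
Proof.
move=> mphi km f0 mf.
have := @integral_kcomp _ _ _ _ _ _ R start step tt (f \o phi).
rewrite /start /step /= => <-//; last exact: measurableT_comp.
have /= <- := @ge0_integral_pushforward _ _ _ _ _ _ mphi (mkcomp start step tt) setT f.
- by apply: eq_measure_integral => /= B mB _; rewrite /pushforward /mkcomp /kcomp km.
- exact: measurableT.
- exact: mf.
- by move=> z _.
Qed.

End mixture.

(** Nonnegativity of the variance.  If f is not square integrable, then the
    right-hand side is infinite. *)
Lemma sqr_fine_expectation_le (R : realType) d (Y : measurableType d)
    (P : probability Y R) (f : Y -> R) : measurable_fun setT f ->
  ((fine 'E_P[f] ^+ 2)%:E <= \int[P]_x (f x ^+ 2)%:E)%E.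
Proof.
move=> mf.
have mf2 : measurable_fun setT (fun x => (f x ^+ 2)%:E).
  by apply/measurable_EFinP; exact: measurable_funX.
have [->|] := eqVneq (\int[P]_x (f x ^+ 2)%:E)%E +oo%E; first exact: leey.
rewrite -ltey => fy.
have fL : f \in Lfun P 2%:E.
  apply/L2P; split => //; apply/integrableP; split => //.
  by under eq_integral do rewrite /= ger0_norm ?sqr_ge0//.
have fL1 : f \in Lfun P 1 by apply: Lfun_subset12 fL; exact: fin_num_measure.
have := variance_ge0 P f; rewrite varianceE//.
have fE := expectation_fin_num fL1.
rewrite sube_ge0 ?fin_numX//.
rewrite -{1}(fineK fE) -EFin_expe => /le_trans; apply.
by rewrite expectation.unlock.
Qed.

(** * Approximation of open sets by continuous functions *)

Section open_approximation.
Context (R : realType) (T : pmetricType R).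

Lemma continuous_borel_measurable (f : T -> R) : continuous f ->
  measurable_fun [set: borel T] f.
Proof.
move=> cf; apply: (measurability _ (RGenOInfty.measurableE R)).
move=> _ [_ [x ->] <-]; rewrite setTI; apply: sub_sigma_algebra.
by apply: open_comp => // y _; exact: cf.
Qed.

(** The distance to the complement of [U], truncated at one so that it is also
    defined when [U] is the whole space. *)
Let gap (U : set T) (x : T) : R := inf ([set 1] `|` [set @mdist R T x y | y in ~` U]).

Let has_inf_gap U x : has_inf ([set 1] `|` [set @mdist R T x y | y in ~` U]).
Proof.
split; first by exists 1; left.
by exists 0 => _ [->//|[y _ <-]]; exact: mdist_ge0.
Qed.

Let gap_ge0 U x : 0 <= gap U x.
Proof.
apply: lb_le_inf; first by exists 1; left.
by move=> _ [->//|[y _ <-]]; exact: mdist_ge0.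
Qed.

Let gap_lipschitz U x z : gap U x <= gap U z + @mdist R T x z.
Proof.
rewrite -lerBlDr; apply: lb_le_inf; first by exists 1; left.
move=> _ [->|[y Uy <-]]; rewrite lerBlDr.
  rewrite (@le_trans _ _ 1) ?lerDl ?mdist_ge0//.
  by apply: ge_inf; [case: (has_inf_gap U x)|left].
rewrite addrC; apply: le_trans (metric_triangle x z y).
by apply: ge_inf; [case: (has_inf_gap U x)|right; exists y].
Qed.

Let continuous_gap U : continuous (gap U).
Proof.
move=> x; apply/cvgrPdist_le => e e0; near=> z.
have xz : @mdist R T x z < e.
  have : ball x e z by near: z; exact: nbhsx_ballx.
  by rewrite ballEmdist.
have := gap_lipschitz U x z; have := gap_lipschitz U z x.
rewrite (metric_sym z x) ler_norml; lra.
Unshelve. all: by end_near. Qed.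

Let gap_eq0 U x : ~ U x -> gap U x = 0.
Proof.
move=> Ux; apply/eqP; rewrite eq_le gap_ge0 andbT -(mdistxx x).
by apply: ge_inf; [case: (has_inf_gap U x)|right; exists x].
Qed.

Let gap_gt0 U x : open U -> U x -> 0 < gap U x.
Proof.
move=> oU Ux; have /nbhs_ballP[e /= e0 xeU] : nbhs x U by exact: open_nbhs_nbhs.
apply: (@lt_le_trans _ _ (Num.min 1 e)); first by rewrite lt_min ltr01.
apply: lb_le_inf; first by exists 1; left.
move=> _ [->|[y Uy <-]]; first by rewrite ge_min lexx.
rewrite ge_min; apply/orP; right; rewrite leNgt; apply/negP => xy; apply: Uy; apply: xeU.
by rewrite ballEmdist.
Qed.

(** The functions min(1, n dist(x, ~U)) are continuous and increase to the
    indicator of [U]. *)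
Lemma open_indic_cvg (U : set T) : open U -> exists g_ : nat -> T -> R,
  [/\ forall n, continuous (g_ n), forall n x, 0 <= g_ n x <= 1 &
      forall x, g_ n x @[n --> \oo] --> (\1_U x : R)].
Proof.
move=> oU; exists (fun n x => Num.min 1 (n%:R * gap U x)); split.
- move=> n x; apply: (@continuous_min R T (cst 1) (fun x => n%:R * gap U x)).
    exact: cvg_cst.
  by apply: cvgM; [exact: cvg_cst|exact: continuous_gap].
- by move=> n x; rewrite le_min ler01 mulr_ge0 ?gap_ge0//= ge_min lexx.
- move=> x; apply: cvg_near_cst; rewrite indicE.
  have [/set_mem Ux|/negP Ux] := boolP (x \in U); last first.
    apply: nearW => n; rewrite gap_eq0 ?mulr0 ?min_r//.
    by move=> /mem_set.
  have g0 := gap_gt0 oU Ux.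
  near=> n; rewrite min_l// -ler_pdivrMr// mul1r.
  by near: n; exact: nbhs_infty_ger.
Unshelve. all: by end_near. Qed.

End open_approximation.

(** * The semigroup on L^2 *)

Section semigroup_L2.
Context (R : realType) (T : pmetricType R) (d : measure_display)
  (Omega : measurableType d) (X : R -> Omega -> borel T)
  (Pr : borel T -> probability Omega R) (P : probability (borel T) R).
Hypotheses (hX : feller_process X Pr) (hP : invariant_law X Pr P).
Implicit Types (f g h : T -> R).

Let S := semigroup X Pr.

Lemma semigroupE t g x : S t g x = fine (\int[Pr x]_w (g (X t w))%:E).
Proof. by rewrite /S /semigroup expectation.unlock. Qed.

Lemma integral_invariant t (f : borel T -> \bar R) : 0 <= t ->
  (forall x, (0 <= f x)%E) -> measurable_fun [set: borel T] f ->
  (\int[P]_x \int[Pr x]_w f (X t w) = \int[P]_x f x)%E.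
Proof.
move=> t0; apply: integral_mixture.
- exact: feller_kernel hX.
- exact: (feller_measurable hX t0).
- by move=> B mB; exact: hP.
Qed.

Lemma measurable_semigroup t g : 0 <= t -> measurable_fun [set: borel T] g ->
  measurable_fun [set: borel T] (S t g).
Proof.
move=> t0 mg; have mX := feller_measurable hX t0.
have mgX : measurable_fun setT (fun w => (g (X t w))%:E).
  exact/measurable_EFinP/(measurableT_comp mg mX).
rewrite (_ : S t g = fun x => fine (\int[Pr x]_w (g (X t w))%:E)); last first.
  by apply/funext => x; rewrite semigroupE.
apply: measurableT_comp => //.
under eq_fun do rewrite integralE.
apply: emeasurable_funB; apply: measurable_fun_integral_kernel => //.
- exact: feller_kernel hX.
- exact: measurable_funepos.
- exact: feller_kernel hX.
- exact: measurable_funeneg.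
Qed.

(** Jensen's inequality at each starting point, averaged over the invariant
    law. *)
Lemma semigroup_contraction t g : 0 <= t -> g \in Lfun P 2%:E ->
  S t g \in Lfun P 2%:E /\ inner P (S t g) (S t g) <= inner P g g.
Proof.
move=> t0 gL; have [mg ig2] := (L2P P g).1 gL; have mX := feller_measurable hX t0.
have mg2 : measurable_fun [set: borel T] (fun x => (g x ^+ 2)%:E).
  by apply/measurable_EFinP; exact: measurable_funX.
have mS := measurable_semigroup t0 mg.
have mS2 : measurable_fun [set: borel T] (fun x => (S t g x ^+ 2)%:E).
  by apply/measurable_EFinP; exact: measurable_funX.
have le2 : (\int[P]_x (S t g x ^+ 2)%:E <= \int[P]_x (g x ^+ 2)%:E)%E.
  rewrite -(integral_invariant (f := fun x => (g x ^+ 2)%:E) t0)//; last first.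
    by move=> x; rewrite lee_fin sqr_ge0.
  apply: ge0_le_integral => //.
  - by move=> x _; rewrite lee_fin sqr_ge0.
  - apply: measurable_fun_integral_kernel => //.
    + exact: feller_kernel hX.
    + by move=> w; rewrite lee_fin sqr_ge0.
    + exact: measurableT_comp mg2 mX.
  - move=> x _; apply: sqr_fine_expectation_le.
    exact: measurableT_comp mg mX.
have SL : S t g \in Lfun P 2%:E.
  apply/L2P; split => //; apply/integrableP; split => //.
  apply: le_lt_trans (integrable_lty measurableT ig2).
  by under eq_integral do rewrite /= ger0_norm ?sqr_ge0//.
split => //; rewrite !inner_Rintegral /Rintegral fine_le//.
- by apply: integrable_fin_num => //; exact: L2_integrableM.
- by apply: integrable_fin_num => //; exact: L2_integrableM.
Qed.

Lemma semigroup_L2 t g : 0 <= t -> g \in Lfun P 2%:E -> S t g \in Lfun P 2%:E.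
Proof. by move=> t0 /(semigroup_contraction t0)[]. Qed.

Lemma ae_integrable_semigroup t g : 0 <= t -> g \in Lfun P 2%:E ->
  \forall x \ae P, (Pr x).-integrable setT (fun w => (g (X t w))%:E).
Proof.
move=> t0 gL; have mX := feller_measurable hX t0.
have ig : P.-integrable [set: borel T] (EFin \o g).
  by apply/Lfun1_integrable; apply: Lfun_subset12 gL; exact: fin_num_measure.
have mg := L2_measurable gL.
have mng : measurable_fun [set: borel T] (fun x => `|g x|%:E).
  by apply/measurable_EFinP; exact: measurableT_comp.
have mI : measurable_fun [set: borel T] (fun x => \int[Pr x]_w `|g (X t w)|%:E)%E.
  apply: measurable_fun_integral_kernel => //.
  - exact: feller_kernel hX.
  - by apply: (measurableT_comp mng mX).
have : P.-integrable [set: borel T] (fun x => \int[Pr x]_w `|g (X t w)|%:E)%E.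
  apply/integrableP; split => //.
  under eq_integral do rewrite gee0_abs ?integral_ge0//.
  rewrite (integral_invariant (f := fun x => `|g x|%:E))//.
  by case/integrableP: ig.
move=> /(integrable_ae measurableT); apply: filterS => x /(_ I) xfin.
apply/integrableP; split; last by rewrite ltey_eq xfin.
exact/measurable_EFinP/(measurableT_comp mg mX).
Qed.

(** Linearity is stated against a test vector because it holds only almost
    everywhere: at exceptional starting points [f] or [g] is not integrable
    along the process. *)
Lemma semigroup_lin t a f g h : 0 <= t -> h \in Lfun P 2%:E ->
  f \in Lfun P 2%:E -> g \in Lfun P 2%:E ->
  inner P h (S t (fun x => a * f x + g x)) = a * inner P h (S t f) + inner P h (S t g).
Proof.
move=> t0 hL fL gL.
have SfL := semigroup_L2 t0 fL; have SgL := semigroup_L2 t0 gL.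
rewrite -inner_linr// !inner_Rintegral /Rintegral; congr fine.
apply: ae_eq_integral => //.
- apply/measurable_EFinP/measurable_funM; first exact: L2_measurable hL.
  exact: L2_measurable (semigroup_L2 t0 (L2_lin a fL gL)).
- apply/measurable_EFinP/measurable_funM; first exact: L2_measurable hL.
  exact: L2_measurable (L2_lin a SfL SgL).
apply: filterS2 (ae_integrable_semigroup t0 fL) (ae_integrable_semigroup t0 gL).
move=> x xf xg _ /=; rewrite !semigroupE.
under eq_integral do rewrite EFinD EFinM.
rewrite integralD//; last exact: integrableZl.
have If := integrable_fin_num measurableT xf.
have Ig := integrable_fin_num measurableT xg.
by rewrite integralZl// fineD ?fineM// fin_numM.
Qed.

Lemma semigroup_inner_bounded t g f : 0 <= t -> g \in Lfun P 2%:E ->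
  f \in Lfun P 2%:E -> inner P g (S t f) ^+ 2 <= inner P g g * inner P f f.
Proof.
move=> t0 gL fL; have [SL Sle] := semigroup_contraction t0 fL.
have /le_trans := inner_CauchySchwarz gL SL; apply.
by rewrite ler_wpM2l// inner_ge0.
Qed.

(** Moving [S t] to the other side of a scalar product reduces statements about
    iterated operators to the linearity and continuity of [inner]. *)
Definition semigroup_adj t : (T -> R) -> (T -> R) := L2adjoint P (S t).

Lemma semigroup_adjP t g : 0 <= t -> g \in Lfun P 2%:E ->
  semigroup_adj t g \in Lfun P 2%:E /\
  forall f, f \in Lfun P 2%:E -> inner P (semigroup_adj t g) f = inner P g (S t f).
Proof.
move=> t0 gL; have [||aL aE] :=
  @represent_spec R T P (fun f => inner P g (S t f)) (inner P g g).
- by move=> a f h fL hL; exact: semigroup_lin.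
- by move=> f fL; exact: semigroup_inner_bounded.
- by split => // f fL; rewrite innerC aE.
Qed.

Lemma semigroupZ t a g f : 0 <= t -> g \in Lfun P 2%:E -> f \in Lfun P 2%:E ->
  inner P g (S t (fun x => a * f x)) = a * inner P g (S t f).
Proof.
move=> t0 gL fL; have [aL aE] := semigroup_adjP t0 gL.
by rewrite -!aE ?innerZr//; exact: L2Z.
Qed.

Lemma semigroup_adj_contraction t g : 0 <= t -> g \in Lfun P 2%:E ->
  inner P (semigroup_adj t g) (semigroup_adj t g) <= inner P g g.
Proof.
move=> t0 gL; have [aL aE] := semigroup_adjP t0 gL.
have := semigroup_inner_bounded t0 gL aL; rewrite -aE//.
have := inner_ge0 P (semigroup_adj t g); rewrite le_eqVlt => /predU1P[<- _|a0].
  exact: inner_ge0.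
by rewrite expr2 ler_pM2r.
Qed.

Lemma semigroup_cvg t g f (f_ : nat -> T -> R) : 0 <= t -> g \in Lfun P 2%:E ->
  f \in Lfun P 2%:E -> (forall n, f_ n \in Lfun P 2%:E) ->
  inner P (fun x => f_ n x - f x) (fun x => f_ n x - f x) @[n --> \oo] --> 0 ->
  inner P g (S t (f_ n)) @[n --> \oo] --> inner P g (S t f).
Proof.
move=> t0 gL fL f_L f_f; have [aL aE] := semigroup_adjP t0 gL.
rewrite -aE//; under eq_fun do rewrite -aE//.
exact: inner_cvgr.
Qed.

(** On indicators this is the Markov property; both sides depend continuously
    on f. *)
Lemma semigroupD s t g f : 0 <= s -> 0 <= t -> g \in Lfun P 2%:E ->
  f \in Lfun P 2%:E -> inner P g (S s (S t f)) = inner P g (S (s + t) f).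
Proof.
move=> s0 t0 gL; have st0 : 0 <= s + t by rewrite addr_ge0.
have [aL aE] := semigroup_adjP s0 gL; move: f.
apply: (@L2_ind _ _ P (fun f => inner P g (S s (S t f)) = inner P g (S (s + t) f))) =>
  [A mA|a f h fL hL ef eh|f f_ fL f_L f_f ef].
- congr inner; apply/funext => x.
  have mXA r : 0 <= r -> measurable (X r @^-1` A).
    by move=> r0; rewrite -[Y in measurable Y]setTI; exact: (feller_measurable hX r0).
  have S1 r y : 0 <= r -> S r \1_A y = fine (Pr y (X r @^-1` A)).
    move=> r0; rewrite semigroupE; congr fine.
    by rewrite -[X r @^-1` A]setIT -integral_indic//; exact: mXA.
  rewrite S1// semigroupE; congr fine; under eq_integral do rewrite S1//.
  rewrite -[Y in Pr x Y]setTI (feller_markov hX)//.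
  + by apply: eq_integral => w _; rewrite fineK// fin_num_measure//; exact: mXA.
  + by have := sigma_algebraC (@sigma_algebra0 _ setT (past X s)); rewrite setC0.
- rewrite semigroup_lin// -ef -eh -!aE; try exact: semigroup_L2.
    by rewrite semigroup_lin.
  exact/semigroup_L2/L2_lin.
- have c1 := semigroup_cvg st0 gL fL f_L f_f.
  have c2 := semigroup_cvg t0 aL fL f_L f_f.
  rewrite -aE; last exact: semigroup_L2.
  rewrite -(cvg_lim _ c1)//.
  rewrite (_ : (fun n => inner P g (S (s + t) (f_ n))) =
     (fun n => inner P (semigroup_adj s g) (S t (f_ n)))).
    by apply/esym/cvg_lim.
  by apply/funext => n; rewrite -ef aE//; exact: semigroup_L2.
Qed.

(** Negative times are sent to 0, so that this is a bounded measurable function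
    on the whole line that need only be used for [0 <= t]. *)
Definition correlation g f (t : R) : R := inner P g (S (Num.max t 0) f).

Lemma correlation_bounded g f t : g \in Lfun P 2%:E -> f \in Lfun P 2%:E ->
  `|correlation g f t| <= Num.sqrt (inner P g g * inner P f f).
Proof.
move=> gL fL; rewrite -sqrtr_sqr ler_wsqrtr// semigroup_inner_bounded//.
by rewrite le_max lexx orbT.
Qed.

(** The pointwise continuity at time zero of the Feller property becomes strong
    continuity in L^2, by dominated convergence. *)
Let null_cvg f (u : nat -> R) : continuous f -> (forall x, `|f x| <= 1) ->
  (forall n, 0 < u n) -> u n @[n --> \oo] --> 0 -> f \in Lfun P 2%:E ->
  inner P (fun x => S (u n) f x - f x) (fun x => S (u n) f x - f x) @[n --> \oo] --> 0.
Proof.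
move=> cf f1 u0 u_0 fL; have mf := L2_measurable fL.
have Sf1 t x : 0 <= t -> `|S t f x| <= 1.
  move=> t0; rewrite semigroupE; have mX := feller_measurable hX t0.
  have mfX : measurable_fun setT (fun w => f (X t w)) by exact: measurableT_comp mf mX.
  rewrite -[leLHS]/(`|\int[Pr x]_(w in setT) (f (X t w))|).
  have iX : (Pr x).-integrable setT (EFin \o (fun w => f (X t w))).
    have i1 : (Pr x).-integrable setT (EFin \o cst 1).
      exact: finite_measure_integrable_cst.
    apply: le_integrable i1 => //.
      exact/measurable_EFinP.
    by move=> w _; rewrite /= lee_fin normr1.
  apply: (le_trans (le_normr_Rintegral measurableT iX)).
  rewrite -[leRHS](_ : \int[Pr x]_(w in setT) (cst 1 w) = 1); last first.
    by rewrite Rintegral_cst// mul1r; exact: (congr1 fine (probability_setT (Pr x))).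
  apply: le_Rintegral => //.
  - exact: integrable_norm.
  - exact: finite_measure_integrable_cst.
(* 4 = (1 + 1)^2 bounds (S f - f)^2 *)
apply: (@L2_dominated_cvg _ _ _ _ _ (cst 4)).
- by move=> n; apply: measurable_semigroup => //; exact: ltW.
- by [].
- exact: finite_measure_integrable_cst.
- move=> n x; have := Sf1 (u n) x (ltW (u0 n)); have := f1 x.
  rewrite !ler_norml /= => /andP[? ?] /andP[? ?]; nra.
- move=> x; have bf : bounded_fun f.
    by exists 1; split => // M /ltW M1 y _; exact: le_trans (f1 y) M1.
  have /cvg_at_rightP := feller_cvg0 hX (x := x) cf bf.
  by apply.
Qed.

Let null_cvg_right f : continuous f -> (forall x, `|f x| <= 1) ->
  f \in Lfun P 2%:E ->
  inner P (fun x => S t f x - f x) (fun x => S t f x - f x) @[t --> 0^'+] --> 0.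
Proof.
move=> cf f1 fL; apply/cvg_at_rightP => u [u0 u_0]; exact: null_cvg.
Qed.

Let correlation_increment g f s t : 0 <= s -> s < t ->
  f \in Lfun P 2%:E -> g \in Lfun P 2%:E ->
  (inner P g (S t f) - inner P g (S s f)) ^+ 2 <= inner P g g *
    inner P (fun x => S (t - s) f x - f x) (fun x => S (t - s) f x - f x).
Proof.
move=> s0 st fL gL; have ts0 : 0 <= t - s by rewrite subr_ge0 ltW.
have [aL aE] := semigroup_adjP s0 gL; have SL := semigroup_L2 ts0 fL.
have {1}-> : t = s + (t - s) by rewrite addrC subrK.
rewrite -semigroupD// -!aE// -innerBr//.
have /le_trans := inner_CauchySchwarz aL (L2B SL fL); apply.
by rewrite ler_wpM2r ?inner_ge0// semigroup_adj_contraction.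
Qed.

(** Strong continuity at time zero propagates to all times through the
    contraction property. *)
Let measurable_correlation_continuous g f : continuous f ->
  (forall x, `|f x| <= 1) -> f \in Lfun P 2%:E -> g \in Lfun P 2%:E ->
  measurable_fun setT (correlation g f).
Proof.
move=> cf f1 fL gL; apply: continuous_measurable_fun => t.
apply/cvgrPdist_le => e e0.
have g1 : 0 < 1 + inner P g g by rewrite ltr_wpDr// inner_ge0.
have /cvgrPdist_le/(_ (e ^+ 2 / (1 + inner P g g))) := null_cvg_right cf f1 fL.
rewrite divr_gt0 ?exprn_gt0// => /(_ isT)[r /= r0 rP].
have inc a b : 0 <= a -> a < b -> b - a < r ->
    `|inner P g (S b f) - inner P g (S a f)| <= e.
  move=> a0 ab bar.
  rewrite -ler_sqr ?nnegrE ?(ltW e0)// real_normK ?num_real//.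
  apply: le_trans (correlation_increment a0 ab fL gL) _.
  have := rP (b - a); rewrite /= !sub0r !normrN !ger0_norm ?inner_ge0//; last first.
    by rewrite subr_ge0 ltW.
  rewrite subr_gt0 => /(_ bar ab); rewrite ler_pdivlMr//; apply: le_trans.
  by rewrite mulrC ler_wpM2l ?inner_ge0// lerDr.
have nb : \forall u \near t, `|t - u| < r by exact: (@nbhsx_ballx R R^o t r r0).
near=> u; have tu : `|t - u| < r by near: u.
have {}tu : `|Num.max t 0 - Num.max u 0| < r.
  apply: le_lt_trans tu; rewrite ler_norml; have := ler_norm (t - u).
  have := ler_norm (u - t); rewrite distrC.
  case: (leP t 0) => ?; case: (leP u 0) => ?; case: (leP 0 (t - u)); lra.
rewrite /correlation; have t0 : 0 <= Num.max t 0 by rewrite le_max lexx orbT.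
have u0 : 0 <= Num.max u 0 by rewrite le_max lexx orbT.
have [lt|gt|->] := ltgtP (Num.max t 0) (Num.max u 0).
- by rewrite distrC; apply: inc => //; apply: le_lt_trans tu; rewrite distrC ler_norm.
- by apply: inc => //; apply: le_lt_trans tu; rewrite ler_norm.
- by rewrite subrr normr0 ltW.
Unshelve. all: by end_near. Qed.

(** The functions f with this property form a closed linear space.  It contains
    the indicators of open sets, limits of continuous functions, hence those of
    Borel sets by Dynkin's theorem, hence everything. *)
Lemma measurable_correlation g f : f \in Lfun P 2%:E -> g \in Lfun P 2%:E ->
  measurable_fun setT (correlation g f).
Proof.
move=> fL; move: g.
pose Q f := forall g, g \in Lfun P 2%:E -> measurable_fun setT (correlation g f).
have m0 (t : R) : 0 <= Num.max t 0 by rewrite le_max lexx orbT.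
have Qlin a f1 f2 : f1 \in Lfun P 2%:E -> f2 \in Lfun P 2%:E -> Q f1 -> Q f2 ->
    Q (fun x => a * f1 x + f2 x).
  move=> f1L f2L Q1 Q2 g gL.
  rewrite (_ : correlation _ _ = fun t => a * correlation g f1 t + correlation g f2 t).
    by apply: measurable_funD; [apply: measurable_funM => //; exact: Q1|exact: Q2].
  by apply/funext => t; rewrite /correlation semigroup_lin.
have Qlim f1 (f_ : nat -> T -> R) : f1 \in Lfun P 2%:E ->
    (forall n, f_ n \in Lfun P 2%:E) ->
    inner P (fun x => f_ n x - f1 x) (fun x => f_ n x - f1 x) @[n --> \oo] --> 0 ->
    (forall n, Q (f_ n)) -> Q f1.
  move=> f1L f_L f_f Qf g gL.
  apply: (@measurable_fun_cvg _ _ _ _ (fun n => correlation g (f_ n))) => [n|t _].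
    exact: Qf.
  exact: semigroup_cvg.
have QT : Q \1_[set: T].
  move=> g gL; rewrite indicT; apply: measurable_correlation_continuous => //.
  - by move=> x; exact: cvg_cst.
  - by move=> x; rewrite normr1.
  - exact: L2_cst.
have Qopen U : open U -> Q \1_U.
  move=> oU; have [g_ [g_c g_01 g_U]] := open_indic_cvg oU.
  have g_L n : g_ n \in Lfun P 2%:E.
    apply: (@L2_bounded _ _ _ _ 1) => [|x]; first exact: continuous_borel_measurable.
    by have /andP[a0 a1] := g_01 n x; rewrite ger0_norm.
  apply: (Qlim _ g_) => //.
  - by apply: L2_indic; exact: sub_sigma_algebra.
  - apply: (@L2_dominated_cvg _ _ _ _ _ (cst 1)) => //.
    + by move=> n; exact: continuous_borel_measurable.
    + by apply: L2_indic; exact: sub_sigma_algebra.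
    + exact: finite_measure_integrable_cst.
    + move=> n x; have /andP[a0 a1] := g_01 n x.
      have /andP[b0 b1] := @indic_itv01 R T U x.
      by move: (g_ n x) (\1_U x) a0 a1 b0 b1 => a b; rewrite /=; nra.
  - move=> n g gL; apply: measurable_correlation_continuous => // x.
    by have /andP[a0 a1] := g_01 n x; rewrite ger0_norm.
have Qindic (A : set (borel T)) : measurable A -> Q \1_A.
  apply: (@dynkin_induction _ (borel T) (@open T) (fun A => Q \1_A)) => //.
  - by move=> U V; exact: openI.
  - move=> V mV QV; rewrite (_ : \1_(~` V) = fun x => -1 * \1_V x + \1_[set: T] x).
      apply: Qlin => //; [exact: L2_indic|exact: L2_indic].
    apply/funext => x; rewrite !indicE in_setC in_setT.
    by case: (x \in V); rewrite /= ?mulr0 ?mulr1 ?add0r// addNr.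
  - move=> F mF tF QF.
    apply: (Qlim _ (fun n (x : T) => \sum_(i < n) (\1_(F i) x : R))).
    + by apply: L2_indic; exact: bigcup_measurable.
    + by move=> n; exact: L2_sum_indic.
    + exact: L2_sum_indic_cvg.
    + elim=> [|n IH].
        rewrite (_ : (fun _ => _) = fun x => -1 * \1_[set: T] x + \1_[set: T] x).
          by apply: Qlin => //; exact: L2_indic.
        by apply/funext => x; rewrite big_ord0 mulN1r addNr.
      rewrite (_ : (fun x => _) =
          (fun x => 1 * \sum_(i < n) (\1_(F i) x : R) + \1_(F n) x)).
        by apply: Qlin => //; [exact: L2_sum_indic|exact: L2_indic].
      by apply/funext => x; rewrite big_ord_recr/= mul1r.
exact: (L2_ind Qindic Qlin Qlim fL).
Qed.

End semigroup_L2.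

(** * Exponential averages on the half-line *)

Section exponential_averages.
Context (R : realType).
Implicit Types (l m s t u : R) (c : R -> R).
Local Notation leb := (@lebesgue_measure R).

(** The exponential kernel of the half-line, extended by zero so that averages
    over the half-line become convolutions on the line. *)
Definition hexp l t : R := if 0 <= t then expR (- (l * t)) else 0.

Lemma hexp_ge0 l t : 0 <= hexp l t.
Proof. by rewrite /hexp; case: ifP => // _; exact: expR_ge0. Qed.

Lemma measurable_hexp l : measurable_fun setT (hexp l).
Proof.
apply: measurable_fun_ifT => //.
  by apply: measurable_fun_ler => //; exact: measurable_cst.
apply: measurableT_comp => //; exact: measurableT_comp.
Qed.

Lemma hexp_exponential_pdf l t : l * hexp l t = exponential_pdf l t.
Proof.
rewrite /hexp; case: (leP 0 t) => t0; last by rewrite lt0_exponential_pdf// mulr0.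
by rewrite exponential_pdfE// mulNr.
Qed.

Lemma integrable_hexp l : 0 < l -> leb.-integrable setT (EFin \o hexp l).
Proof.
move=> l0; have := integrableZl measurableT l^-1 (integrable_exponential_pdf l0).
apply: eq_integrable => // t _.
by rewrite /comp -EFinM -hexp_exponential_pdf mulrA mulVf ?gt_eqF// mul1r.
Qed.

(** The parameter [l] may be zero or negative, which yields the two bounds that
    make up [damp]; positive [l] yields the resolvent equation. *)
Lemma integral_hexp_conv l m u : l != m ->
  (\int[leb]_s (hexp l s * hexp m (u - s))%:E = ((hexp l u - hexp m u) / (m - l))%:E)%E.
Proof.
move=> lm; have ml0 : m - l != 0 by rewrite subr_eq0 eq_sym.
have E s : hexp l s * hexp m (u - s) =
    (fun s => expR (- (m * u)) * expR ((m - l) * s)) s * \1_`[0, u] s.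
  rewrite /hexp indicE mem_setE in_itv/= subr_ge0.
  case: (leP 0 s) => s0 /=; last by rewrite mul0r mulr0.
  case: (leP s u) => su; last by rewrite !mulr0.
  by rewrite mulr1 -!expRD; congr expR; ring.
under eq_integral do rewrite E EFinM.
have -> : (\int[leb]_s ((expR (- (m * u)) * expR ((m - l) * s))%:E * (\1_`[0%R, u] s)%:E) =
   \int[leb]_(s in `[0%R, u]) (expR (- (m * u)) * expR ((m - l) * s))%:E)%E.
  by rewrite [RHS]integral_mkcond; apply: eq_integral => s _; rewrite epatch_indic.
rewrite /hexp; case: (ltgtP 0 u) => u0.
- pose F s := (m - l)^-1 * (expR (- (m * u)) * expR ((m - l) * s)).
  have dF s : is_derive s 1 F (expR (- (m * u)) * expR ((m - l) * s)).
    rewrite /F; apply: is_derive_eq.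
    by rewrite /GRing.scale /=; field.
  rewrite (@continuous_FTC2 _ _ F)//.
  + rewrite -EFinB /F; congr EFin.
    rewrite -!expRD mulr0 addr0 (_ : - (m * u) + (m - l) * u = - (l * u)); last by ring.
    by rewrite mulrBl [in RHS]mulrC [X in _ - X = _]mulrC mulrC.
  + apply: continuous_subspaceT => s; apply: differentiable_continuous.
    exact/derivable1_diffP.
  + split => [s _||].
    * by have [] := dF s.
    * apply: cvg_at_right_filter; apply: differentiable_continuous.
      by apply/derivable1_diffP; have [] := dF 0.
    * apply: cvg_at_left_filter; apply: differentiable_continuous.
      by apply/derivable1_diffP; have [] := dF u.
  + by move=> s _; rewrite derive1E; have [_ ->] := dF s.
- by rewrite set_itv_ge ?integral_set0 ?subrr ?mul0r// bnd_simp -ltNge.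
- by rewrite -u0 set_itv1 integral_set1 !mulr0 subrr mul0r.
Qed.

Lemma lebesgue_measure_shift s (A : set R) : measurable A ->
  pushforward leb (+%R s : _ -> measurableTypeR R) A = leb A.
Proof.
move=> mA; apply/esym/lebesgue_measure_unique => //=.
  exact: measurable_funD.
move=> ms _ [[a b]] _ <-; rewrite /pushforward.
rewrite (_ : _ @^-1` _ = `]a - s, b - s]%classic).
  rewrite !lebesgue_measure_itv/= !lte_fin ltrD2r; case: ifP => // _.
  by rewrite -!EFinB; congr EFin; ring.
by apply/seteqP; split => t /=; rewrite !in_itv/= ltrBlDl lerBrDl.
Qed.

Lemma ge0_integral_shift s (f : R -> \bar R) : measurable_fun setT f ->
  (forall t, (0 <= f t)%E) -> (\int[leb]_t f (s + t)%R = \int[leb]_t f t)%E.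
Proof.
move=> mf f0; have ms : measurable_fun setT (+%R s : measurableTypeR R -> measurableTypeR R).
  exact: measurable_funD.
have := @ge0_integral_pushforward _ _ _ _ _ _ ms leb setT f measurableT mf.
rewrite preimage_setT => <-//.
by apply: eq_measure_integral => //= A mA _; exact: lebesgue_measure_shift.
Qed.

Lemma integral_shift s (f : R -> \bar R) : leb.-integrable setT f ->
   (\int[leb]_t f (s + t)%R = \int[leb]_t f t)%E.
Proof.
move=> /integrableP[mf iF].
have ms : measurable_fun setT (+%R s : measurableTypeR R -> measurableTypeR R).
  exact: measurable_funD.
have := @integral_pushforward _ _ _ _ _ _ ms leb setT f mf.
rewrite preimage_setT => <-//.
  by apply: eq_measure_integral => //= A mA _; exact: lebesgue_measure_shift.
apply/integrableP; split; first exact: measurableT_comp.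
by rewrite /= (@ge0_integral_shift s (fun t => `|f t|%E))//; exact: measurableT_comp.
Qed.

Lemma measurable_hexp_shift m c s : measurable_fun setT c ->
  measurable_fun setT (fun u => hexp m (u - s) * c u).
Proof.
move=> mc; apply: measurable_funM => //; apply: measurableT_comp (measurable_hexp m) _.
exact: measurable_funB.
Qed.

Let measurable_kernel m (w c : R -> R) : measurable_fun setT w ->
  measurable_fun setT c ->
  measurable_fun setT (fun p : measurableTypeR R * measurableTypeR R =>
    (w p.1 * (hexp m (p.2 - p.1) * c p.2))%:E).
Proof.
move=> mw mc; apply/measurable_EFinP; apply: measurable_funM.
  exact: measurableT_comp mw measurable_fst.
apply: measurable_funM.
  apply: measurableT_comp (measurable_hexp m) _.
  by apply: measurable_funB; [exact: measurable_snd|exact: measurable_fst].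
exact: measurableT_comp mc measurable_snd.
Qed.

(** The exponential average of [c] is transferred to the weight [w]. *)
Lemma tonelli_hexp m (w c : R -> R) : measurable_fun setT w ->
  measurable_fun setT c -> (forall s, 0 <= w s) -> (forall s, 0 <= c s) ->
  (\int[leb]_s ((w s)%:E * \int[leb]_t (hexp m t * c (s + t)%R)%:E) =
   \int[leb]_u ((c u)%:E * \int[leb]_s (w s * hexp m (u - s))%:E))%E.
Proof.
move=> mw mc w0 c0.
transitivity (\int[leb]_s \int[leb]_u (w s * (hexp m (u - s) * c u))%:E)%E.
  apply: eq_integral => s _.
  under [RHS]eq_integral do rewrite EFinM.
  rewrite ge0_integralZl//; first last.
  - by rewrite lee_fin.
  - by move=> u _; rewrite lee_fin mulr_ge0// hexp_ge0.
  - by apply/measurable_EFinP; exact: measurable_hexp_shift.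
  rewrite -(@ge0_integral_shift s (fun u => (hexp m (u - s) * c u)%:E)).
  - by congr (_ * _)%E; apply: eq_integral => t _; rewrite (addrC s) addrK addrC.
  - by apply/measurable_EFinP; exact: measurable_hexp_shift.
  - by move=> u; rewrite lee_fin mulr_ge0// hexp_ge0.
rewrite (@fubini_tonelli _ _ _ _ _ leb leb _ (measurable_kernel m mw mc))//; last first.
  by move=> p; rewrite lee_fin !mulr_ge0// hexp_ge0.
apply: eq_integral => u _ /=.
under eq_integral do rewrite mulrA mulrC EFinM.
rewrite ge0_integralZl ?lee_fin//.
- apply/measurable_EFinP/measurable_funM => //.
  by apply: measurableT_comp (measurable_hexp m) _; exact: measurable_funB.
- by move=> s _; rewrite lee_fin mulr_ge0// hexp_ge0.
Qed.

Lemma integrable_hexpM l c (M : R) : 0 < l -> measurable_fun setT c ->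
  (forall t, `|c t| <= M) -> leb.-integrable setT (fun t => (hexp l t * c t)%:E).
Proof.
move=> l0 mc cM; have := integrableZl measurableT M (integrable_hexp l0).
apply: le_integrable => //.
  by apply/measurable_EFinP/measurable_funM => //; exact: measurable_hexp.
move=> t _; rewrite /= lee_fin normrM mulrC.
rewrite (ger0_norm (hexp_ge0 l t)) [leRHS]ger0_norm ?mulr_ge0 ?hexp_ge0//.
  by rewrite ler_wpM2r ?hexp_ge0.
exact: le_trans (cM 0).
Qed.

Let integral_hexp_shift m c (M : R) s : 0 < m -> measurable_fun setT c ->
  (forall t, `|c t| <= M) ->
  leb.-integrable setT (fun u => (hexp m (u - s) * c u)%:E) /\
  (\int[leb]_t (hexp m t * c (s + t)%R)%:E =
   \int[leb]_u (hexp m (u - s) * c u)%:E)%E.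
Proof.
move=> m0 mc cM.
have E t : hexp m t * c (s + t) = hexp m (s + t - s) * c (s + t).
  by rewrite (addrC s) addrK addrC.
have mf : measurable_fun setT (fun u => (hexp m (u - s) * c u)%:E).
  by apply/measurable_EFinP; exact: measurable_hexp_shift.
have mcs : measurable_fun setT (fun t => c (s + t)).
  by apply: measurableT_comp mc _; exact: measurable_funD.
have i_ : leb.-integrable setT (fun u => (hexp m (u - s) * c u)%:E).
  apply/integrableP; split => //.
  rewrite -(@ge0_integral_shift s (fun u => `|(hexp m (u - s) * c u)%:E|%E))//; last first.
    exact: measurableT_comp.
  under eq_integral do rewrite -E.
  by case/integrableP: (integrable_hexpM m0 mcs (fun t => cM (s + t))).
split=> //; under eq_integral do rewrite E.
exact: (@integral_shift s (fun u => (hexp m (u - s) * c u)%:E)).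
Qed.

(** The resolvent equation, read on a single correlation function: Fubini's
    theorem reduces it to the convolution of two exponential kernels. *)
Lemma resolvent_average l m c (M : R) : 0 < l -> 0 < m -> l != m ->
  measurable_fun setT c -> (forall t, `|c t| <= M) ->
  (m - l) * \int[leb]_s (hexp l s * \int[leb]_t (hexp m t * c (s + t))) =
  \int[leb]_t (hexp l t * c t) - \int[leb]_t (hexp m t * c t).
Proof.
move=> l0 m0 lm mc cM; have ml0 : m - l != 0 by rewrite subr_eq0 eq_sym.
have il := integrable_hexpM l0 mc cM; have im := integrable_hexpM m0 mc cM.
have mK := measurable_kernel m (measurable_hexp l) mc.
have conv_int u : leb.-integrable setT (fun s => (hexp l s * hexp m (u - s))%:E).
  apply/integrableP; split.
    apply/measurable_EFinP/measurable_funM; first exact: measurable_hexp.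
    by apply: measurableT_comp (measurable_hexp m) _; exact: measurable_funB.
  under eq_integral do rewrite gee0_abs ?lee_fin ?mulr_ge0 ?hexp_ge0//.
  by rewrite integral_hexp_conv// ltry.
have iK : (leb \x leb)%E.-integrable setT (fun p : measurableTypeR R * measurableTypeR R =>
    (hexp l p.1 * (hexp m (p.2 - p.1) * c p.2))%:E).
  apply/(integrable21ltyP leb leb mK).
  have E u : (\int[leb]_s `|(hexp l s * (hexp m (u - s) * c u))%:E| =
      `|((m - l)^-1 * (hexp l u * c u - hexp m u * c u))%:E|)%E.
    under eq_integral do rewrite mulrA EFinM abseM.
    rewrite integralZr//; last exact: integrable_abse.
    under eq_integral do rewrite gee0_abs ?lee_fin ?mulr_ge0 ?hexp_ge0//.
    have c0 : 0 <= (hexp l u - hexp m u) / (m - l).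
      rewrite -lee_fin -integral_hexp_conv//; apply: integral_ge0 => s _.
      by rewrite lee_fin mulr_ge0 ?hexp_ge0.
    rewrite integral_hexp_conv// !abse_EFin -EFinM -(ger0_norm c0) -normrM.
    by congr (`|_|%:E); field.
  under eq_integral do rewrite E.
  have := integrableZl measurableT (m - l)^-1 (integrableB measurableT il im).
  by case/integrableP.
have -> : \int[leb]_s (hexp l s * \int[leb]_t (hexp m t * c (s + t))) =
    fine (\int[leb]_s \int[leb]_u (hexp l s * (hexp m (u - s) * c u))%:E)%E.
  rewrite /Rintegral; congr fine; apply: eq_integral => s _.
  have [is_ ->] := integral_hexp_shift s m0 mc cM.
  under [RHS]eq_integral do rewrite EFinM.
  by rewrite integralZl// EFinM fineK//; exact: integrable_fin_num.
rewrite (Fubini iK) [in RHS]/Rintegral.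
rewrite -fineB; try exact: integrable_fin_num.
rewrite -integralB_EFin//.
have -> : (\int[leb]_u \int[leb]_s (hexp l s * (hexp m (u - s) * c u))%:E =
   \int[leb]_u ((m - l)^-1%:E * (hexp l u * c u - hexp m u * c u)%:E))%E.
  apply: eq_integral => u _.
  under eq_integral do rewrite mulrA EFinM.
  rewrite integralZr// integral_hexp_conv// -!EFinM; congr EFin; ring.
have iB := integrableB measurableT il im.
rewrite integralZl//.
have Bfin : (\int[leb]_u (hexp l u * c u - hexp m u * c u)%:E)%E \is a fin_num.
  exact: integrable_fin_num.
by rewrite fineM// mulrA divff// mul1r.
Qed.

(** A bound for the probability that a sum of [j] independent exponential times
    of mean at least one does not exceed [t]: it is at most 1, and at most
    2^-j e^t by the Markov inequality applied to the exponential of minus the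
    sum. *)
Definition damp (j : nat) t : R := Num.min (hexp 0 t) (2^-1 ^+ j * hexp (-1) t).

Lemma damp_ge0 j t : 0 <= damp j t.
Proof. by rewrite le_min hexp_ge0 mulr_ge0 ?hexp_ge0// exprn_ge0. Qed.

Lemma damp_le_hexp j t : damp j t <= hexp 0 t.
Proof. by rewrite ge_min lexx. Qed.

Lemma damp0 t : damp 0 t = hexp 0 t.
Proof.
rewrite /damp expr0 mul1r min_l// /hexp; case: ifP => // t0.
by rewrite ler_expR mul0r mulN1r opprK oppr0.
Qed.

Lemma damp_le j k t : (j <= k)%N -> damp k t <= damp j t.
Proof.
move=> jk; rewrite /damp le_min ge_min lexx/= ge_min; apply/orP; right.
rewrite ler_wpM2r ?hexp_ge0// ler_wiXn2l//; lra.
Qed.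

Lemma measurable_damp j : measurable_fun setT (damp j).
Proof.
apply: measurable_minr; first exact: measurable_hexp.
by apply: measurable_funM => //; exact: measurable_hexp.
Qed.

(** One more exponential time of rate m <= 1, whose Laplace transform at 1 is
    m / (m + 1) <= 1 / 2. *)
Lemma damp_conv m j u : 0 < m <= 1 ->
  (m%:E * \int[leb]_s (damp j s * hexp m (u - s))%:E <= (damp j.+1 u)%:E)%E.
Proof.
move=> /andP[m0 m1].
have mc l : measurable_fun setT (fun s => (hexp l s * hexp m (u - s))%:E).
  apply/measurable_EFinP/measurable_funM; first exact: measurable_hexp.
  by apply: measurableT_comp (measurable_hexp m) _; exact: measurable_funB.
have md : measurable_fun setT (fun s => (damp j s * hexp m (u - s))%:E).
  apply/measurable_EFinP/measurable_funM; first exact: measurable_damp.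
  by apply: measurableT_comp (measurable_hexp m) _; exact: measurable_funB.
rewrite EFin_min le_min; apply/andP; split.
  apply: (@le_trans _ _ (m%:E * \int[leb]_s (hexp 0 s * hexp m (u - s))%:E)%E).
    rewrite lee_pmul2l ?lte_fin//; apply: ge0_le_integral => //.
    - by move=> s _; rewrite lee_fin mulr_ge0 ?damp_ge0 ?hexp_ge0.
    - exact: mc.
    - by move=> s _; rewrite lee_fin ler_wpM2r ?hexp_ge0// damp_le_hexp.
  rewrite integral_hexp_conv ?lt_eqF// -EFinM lee_fin subr0 mulrC divfK ?gt_eqF//.
  by rewrite lerBlDr lerDl hexp_ge0.
apply: (@le_trans _ _ (m%:E *
    \int[leb]_s ((2^-1 ^+ j)%:E * (hexp (-1) s * hexp m (u - s))%:E))%E).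
  rewrite lee_pmul2l ?lte_fin//; apply: ge0_le_integral => //.
  - by move=> s _; rewrite lee_fin mulr_ge0 ?damp_ge0 ?hexp_ge0.
  - by apply: measurable_funeM; exact: mc.
  - by move=> s _; rewrite -EFinM lee_fin mulrA ler_wpM2r ?hexp_ge0// ge_min lexx orbT.
rewrite ge0_integralZl ?lee_fin ?exprn_ge0//; last 2 first.
- exact: mc.
- by move=> s _; rewrite lee_fin mulr_ge0 ?hexp_ge0.
rewrite integral_hexp_conv; last by rewrite lt_eqF//; lra.
rewrite -!EFinM lee_fin exprS opprK.
have := hexp_ge0 m u; have := hexp_ge0 (-1) u.
have : 0 < 2^-1 ^+ j :> R by rewrite exprn_gt0.
move: (hexp m u) (hexp (-1) u) (2^-1 ^+ j) => a b e e0 b0 a0.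
rewrite (_ : m * (e * ((b - a) / (m + 1))) = e * (m * (b - a)) / (m + 1)); last by ring.
rewrite ler_pdivrMr; last lra.
rewrite -subr_ge0 (_ : _ - _ = e * (2^-1 * b * (1 - m) + m * a)); last by field.
apply: mulr_ge0; first exact: ltW.
by apply: addr_ge0; apply: mulr_ge0; lra.
Qed.

(** An exponential average is paid for by one unit of damping. *)
Lemma damp_average m j (c c' : R -> R) : 0 < m <= 1 ->
  measurable_fun setT c -> measurable_fun setT c' ->
  (forall s, 0 <= s -> c' s = m * \int[leb]_t (hexp m t * c (s + t))) ->
  (\int[leb]_s (damp j s * `|c' s|)%:E <= \int[leb]_u (damp j.+1 u * `|c u|)%:E)%E.
Proof.
move=> m01 mc mc' c'E; have /andP[m0 m1] := m01.
have mn : measurable_fun setT (fun u => `|c u|) by exact: measurableT_comp.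
have mh s : measurable_fun setT (fun t => (hexp m t * c (s + t))%:E).
  apply/measurable_EFinP/measurable_funM; first exact: measurable_hexp.
  by apply: measurableT_comp mc _; exact: measurable_funD.
have mw : measurable_fun setT (fun s => m * damp j s).
  by apply: measurable_funM => //; exact: measurable_damp.
have w0 s : 0 <= m * damp j s by rewrite mulr_ge0 ?damp_ge0// ltW.
have mhn s : measurable_fun setT (fun t => (hexp m t * `|c (s + t)|)%:E).
  apply/measurable_EFinP/measurable_funM; first exact: measurable_hexp.
  by apply: measurableT_comp mn _; exact: measurable_funD.
have measurable_inner : measurable_fun setT
    (fun s => (m * damp j s)%:E * \int[leb]_t (hexp m t * `|c (s + t)%R|)%:E)%E.
  apply: emeasurable_funM; first exact/measurable_EFinP.
  have mK : measurable_fun setT (fun p : measurableTypeR R * measurableTypeR R =>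
      (hexp m p.2 * `|c (p.1 + p.2)|)%:E).
    apply/measurable_EFinP/measurable_funM.
      exact: measurableT_comp (measurable_hexp m) measurable_snd.
    apply: measurableT_comp mn _.
    by apply: measurable_funD; [exact: measurable_fst|exact: measurable_snd].
  apply: (@measurable_fun_fubini_tonelli_F _ _ _ _ _ leb _ mK) => p.
  by rewrite lee_fin mulr_ge0// hexp_ge0.
have measurable_outer : measurable_fun setT
    (fun u => (`|c u|)%:E * \int[leb]_s (m * damp j s * hexp m (u - s))%:E)%E.
  apply: emeasurable_funM; first exact/measurable_EFinP.
  have mK : measurable_fun setT (fun p : measurableTypeR R * measurableTypeR R =>
      (m * damp j p.2 * hexp m (p.1 - p.2))%:E).
    apply/measurable_EFinP/measurable_funM.
      exact: measurableT_comp mw measurable_snd.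
    apply: measurableT_comp (measurable_hexp m) _.
    by apply: measurable_funB; [exact: measurable_fst|exact: measurable_snd].
  apply: (@measurable_fun_fubini_tonelli_F _ _ _ _ _ leb _ mK) => p.
  by rewrite lee_fin mulr_ge0// hexp_ge0.
apply: (@le_trans _ _ (\int[leb]_s ((m * damp j s)%:E *
    \int[leb]_t (hexp m t * `|c (s + t)%R|)%:E))%E).
  apply: ge0_le_integral => //.
  - by move=> s _; rewrite lee_fin mulr_ge0 ?damp_ge0.
  - apply/measurable_EFinP/measurable_funM; first exact: measurable_damp.
    exact: measurableT_comp.
  - move=> s _; have [s0|s0] := leP 0 s; last first.
      have d0 : damp j s = 0.
        apply/eqP; rewrite eq_le damp_ge0 (le_trans (damp_le_hexp j s))//.
        by rewrite /hexp (lt_geF s0).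
      by rewrite d0 mul0r mulr0 mul0e.
    rewrite c'E// normrM (gtr0_norm m0) mulrA (mulrC _ m) EFinM lee_wpmul2l ?lee_fin//.
    rewrite /Rintegral.
    apply: (@le_trans _ _ `|\int[leb]_t (hexp m t * c (s + t)%R)%:E|%E).
      by case: (\int[leb]_t _)%E => [r| |] //=; rewrite normr0 leey.
    apply: (le_trans (le_abse_integral leb measurableT (mh s))).
    apply: ge0_le_integral => //.
    + by apply: measurableT_comp (mh s).
    + exact: mhn.
    + by move=> t _; rewrite /= normrM (ger0_norm (hexp_ge0 m t)).
rewrite (@tonelli_hexp m (fun s => m * damp j s) (fun u => `|c u|))//.
apply: ge0_le_integral => //.
- move=> u _; rewrite mule_ge0 ?lee_fin//; apply: integral_ge0 => s _.
  by rewrite lee_fin mulr_ge0 ?hexp_ge0.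
- by apply/measurable_EFinP/measurable_funM => //; exact: measurable_damp.
- move=> u _; rewrite [leRHS]EFinM [leRHS]muleC lee_wpmul2l ?lee_fin//.
  apply: le_trans (damp_conv j u m01).
  under eq_integral do rewrite -mulrA EFinM.
  rewrite ge0_integralZl ?lee_fin ?(ltW m0)//.
    apply/measurable_EFinP/measurable_funM; first exact: measurable_damp.
    by apply: measurableT_comp (measurable_hexp m) _; exact: measurable_funB.
  by move=> s _; rewrite lee_fin mulr_ge0 ?damp_ge0 ?hexp_ge0.
Qed.

Lemma damp_cvg0 (c : R -> R) : measurable_fun setT c ->
  (\int[leb]_t (hexp 0 t * `|c t|)%:E < +oo)%E ->
  (\int[leb]_t (damp j t * `|c t|)%:E)%E @[j --> \oo] --> 0%E.
Proof.
move=> mc c_fin.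
have mn : measurable_fun setT (fun u => `|c u|) by exact: measurableT_comp.
rewrite -[X in _ --> X](@integral0 _ _ _ leb setT).
apply: (@dominated_cvg _ _ _ leb _ measurableT (fun j t => (damp j t * `|c t|)%:E)
  (cst 0%E) (fun t => (hexp 0 t * `|c t|)%:E)) => //.
- by move=> j; apply/measurable_EFinP/measurable_funM => //; exact: measurable_damp.
- move=> t _; apply: cvg_EFin; first exact: nearW.
  apply: (@squeeze_cvgr _ _ _ _ (cst 0) (fun j => 2^-1 ^+ j * (hexp (-1) t * `|c t|))).
  + apply: nearW => j; rewrite /= mulr_ge0 ?damp_ge0//= mulrA ler_wpM2r//.
    by rewrite ge_min lexx orbT.
  + exact: cvg_cst.
  + rewrite -(mul0r (hexp (-1) t * `|c t|)); apply: cvgMl.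
    by apply: cvg_expr; rewrite ger0_norm; lra.
- apply/integrableP; split.
    by apply/measurable_EFinP/measurable_funM => //; exact: measurable_hexp.
  under eq_integral do rewrite gee0_abs ?lee_fin ?mulr_ge0 ?hexp_ge0//.
  exact: c_fin.
- move=> j t _; rewrite gee0_abs lee_fin ?mulr_ge0 ?damp_ge0//.
  by rewrite ler_wpM2r// damp_le_hexp.
Qed.

End exponential_averages.

(** * The resolvent and its adjoint *)

Section resolvent_L2.
Context (R : realType) (T : pmetricType R) (d : measure_display)
  (Omega : measurableType d) (X : R -> Omega -> borel T)
  (Pr : borel T -> probability Omega R) (P : probability (borel T) R).
Hypotheses (hX : feller_process X Pr) (hP : invariant_law X Pr P).
Implicit Types (f g h : T -> R) (l m s t : R).
Local Notation leb := (@lebesgue_measure R).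

Let S := semigroup X Pr.
Let G := resolvent X Pr P.
Let Gs := resolvent_adj X Pr P.
Let corr := correlation X Pr P.

Let corrE g f t : 0 <= t -> corr g f t = inner P g (S t f).
Proof. by move=> t0; rewrite /corr /correlation max_l. Qed.

Let laplace_corrE l g f :
  \int[leb]_(t in `[0, +oo[) (expR (- (l * t)) * inner P g (S t f)) =
  \int[leb]_t (hexp l t * corr g f t).
Proof.
rewrite Rintegral_mkcond; apply: eq_Rintegral => t _.
rewrite patchE mem_setE in_itv/= andbT /hexp; case: ifP => t0; last by rewrite mul0r.
by rewrite corrE.
Qed.

Let integrable_corr l g f : 0 < l -> g \in Lfun P 2%:E -> f \in Lfun P 2%:E ->
  leb.-integrable setT (fun t => (hexp l t * corr g f t)%:E).
Proof.
move=> l0 gL fL; apply: integrable_hexpM => //; first exact: measurable_correlation.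
by move=> t; exact: correlation_bounded.
Qed.

Let m0 t : 0 <= Num.max t 0.
Proof. by rewrite le_max lexx orbT. Qed.

Let laplace_linl l a g h f : 0 < l -> g \in Lfun P 2%:E -> h \in Lfun P 2%:E ->
  f \in Lfun P 2%:E ->
  \int[leb]_t (hexp l t * corr (fun x => a * g x + h x) f t) =
  a * \int[leb]_t (hexp l t * corr g f t) + \int[leb]_t (hexp l t * corr h f t).
Proof.
move=> l0 gL hL fL.
have ig := integrable_corr l0 gL fL; have ih := integrable_corr l0 hL fL.
rewrite -RintegralZl// -RintegralD//; last exact: (integrableZl measurableT a ig).
apply: eq_Rintegral => t _; rewrite /corr /correlation.
have SL := semigroup_L2 hX hP (m0 t) fL.
by rewrite innerC inner_linr// ![inner P (semigroup _ _ _ _) _]innerC; ring.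
Qed.

Let laplace_linr l a g h f : 0 < l -> g \in Lfun P 2%:E -> h \in Lfun P 2%:E ->
  f \in Lfun P 2%:E ->
  \int[leb]_t (hexp l t * corr f (fun x => a * g x + h x) t) =
  a * \int[leb]_t (hexp l t * corr f g t) + \int[leb]_t (hexp l t * corr f h t).
Proof.
move=> l0 gL hL fL.
have ig := integrable_corr l0 fL gL; have ih := integrable_corr l0 fL hL.
rewrite -RintegralZl// -RintegralD//; last exact: (integrableZl measurableT a ig).
apply: eq_Rintegral => t _; rewrite /corr /correlation.
by rewrite semigroup_lin//; ring.
Qed.

Let laplace_bounded l g f : 0 < l -> g \in Lfun P 2%:E -> f \in Lfun P 2%:E ->
  (\int[leb]_t (hexp l t * corr g f t)) ^+ 2 <=
  (\int[leb]_t hexp l t) ^+ 2 * (inner P g g * inner P f f).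
Proof.
move=> l0 gL fL; set M := inner P g g * inner P f f.
have M0 : 0 <= M by rewrite mulr_ge0 ?inner_ge0.
have ic := integrable_corr l0 gL fL.
have I0 : 0 <= \int[leb]_t hexp l t by apply: Rintegral_ge0 => t _; exact: hexp_ge0.
rewrite -[M]sqr_sqrtr// -exprMn -real_normK ?num_real//.
rewrite ler_sqr ?nnegrE ?mulr_ge0 ?sqrtr_ge0//.
apply: (le_trans (le_normr_Rintegral measurableT ic)).
rewrite -RintegralZr//; last exact: integrable_hexp.
apply: le_Rintegral => //.
- exact: integrable_norm.
- exact: (integrableZr measurableT (Num.sqrt M) (integrable_hexp l0)).
- move=> t _; rewrite normrM (ger0_norm (hexp_ge0 l t)) ler_wpM2l ?hexp_ge0//.
  exact: correlation_bounded.
Qed.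

(** The Laplace transform is a functional of norm at most the integral of
    [hexp l], so it is represented. *)
Lemma resolventP l g : 0 < l -> g \in Lfun P 2%:E ->
  G l g \in Lfun P 2%:E /\ forall f, f \in Lfun P 2%:E ->
    inner P f (G l g) = \int[leb]_t (hexp l t * corr f g t).
Proof.
move=> l0 gL.
have [||GL GE] := @represent_spec R T P
    (fun f => \int[leb]_(t in `[0, +oo[) (expR (- (l * t)) * inner P f (S t g)))
    ((\int[leb]_t hexp l t) ^+ 2 * inner P g g).
- by move=> a f h fL hL; rewrite !laplace_corrE laplace_linl.
- move=> f fL; rewrite laplace_corrE -mulrA [X in _ * X]mulrC.
  exact: laplace_bounded.
- by split => // f fL; rewrite GE// laplace_corrE.
Qed.

Lemma resolvent_adjP l g : 0 < l -> g \in Lfun P 2%:E ->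
  Gs l g \in Lfun P 2%:E /\ forall f, f \in Lfun P 2%:E ->
    inner P (Gs l g) f = inner P g (G l f).
Proof.
move=> l0 gL.
have GE f : f \in Lfun P 2%:E ->
    inner P g (G l f) = \int[leb]_t (hexp l t * corr g f t).
  by move=> fL; have [_ ->] := resolventP l0 fL.
have [||GsL GsE] := @represent_spec R T P (fun f => inner P g (G l f))
    ((\int[leb]_t hexp l t) ^+ 2 * inner P g g).
- by move=> a f h fL hL; rewrite !GE ?laplace_linr//; exact: L2_lin.
- by move=> f fL; rewrite GE// -mulrA; exact: laplace_bounded.
- by split => // f fL; rewrite innerC GsE.
Qed.

Lemma resolventZ l a g f : 0 < l -> g \in Lfun P 2%:E -> f \in Lfun P 2%:E ->
  inner P g (G l (fun x => a * f x)) = a * inner P g (G l f).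
Proof.
move=> l0 gL fL; have [_ GE] := resolventP l0 fL.
have [_ GaE] := resolventP l0 (L2Z a fL).
rewrite GE// GaE// -RintegralZl//; last exact: integrable_corr.
apply: eq_Rintegral => t _; rewrite /corr /correlation semigroupZ//; ring.
Qed.

(** Under the adjoint of [S s], the weak integral that defines the resolvent is
    tested against another vector, and the semigroup law shifts the time. *)
Lemma inner_semigroup_resolvent m s g f : 0 < m -> 0 <= s ->
  g \in Lfun P 2%:E -> f \in Lfun P 2%:E ->
  inner P g (S s (G m f)) = \int[leb]_t (hexp m t * corr g f (s + t)).
Proof.
move=> m_gt0 s0 gL fL; have [aL aE] := semigroup_adjP hX hP s0 gL.
have [GL GE] := resolventP m_gt0 fL.
rewrite -aE// GE//; apply: eq_Rintegral => t _; rewrite /hexp.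
case: ifP => t0; last by rewrite !mul0r.
rewrite !corrE ?addr_ge0// aE; last exact: semigroup_L2.
by congr (_ * _); exact: semigroupD.
Qed.

Lemma inner_resolvent_adj_semigroup m s g f : 0 < m -> 0 <= s ->
  g \in Lfun P 2%:E -> f \in Lfun P 2%:E ->
  inner P (Gs m g) (S s f) = \int[leb]_t (hexp m t * corr g f (s + t)).
Proof.
move=> m_gt0 s0 gL fL; have SL := semigroup_L2 hX hP s0 fL.
have [_ GsE] := resolvent_adjP m_gt0 gL; have [_ GE] := resolventP m_gt0 SL.
rewrite GsE// GE//; apply: eq_Rintegral => t _; rewrite /hexp.
case: ifP => t0; last by rewrite !mul0r.
by rewrite !corrE ?addr_ge0// addrC; congr (_ * _); exact: semigroupD.
Qed.

Lemma resolvent_identity l m g f : 0 < l -> 0 < m -> l != m ->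
  g \in Lfun P 2%:E -> f \in Lfun P 2%:E ->
  (m - l) * inner P g (G l (G m f)) = inner P g (G l f) - inner P g (G m f).
Proof.
move=> l0 m_gt0 lm gL fL; have [GmL GmE] := resolventP m_gt0 fL.
have [_ ->//] := resolventP l0 GmL; have [_ ->//] := resolventP l0 fL; rewrite GmE//.
rewrite -(@resolvent_average _ l m (corr g f) (Num.sqrt (inner P g g * inner P f f)))//.
- congr (_ * _); apply: eq_Rintegral => s _; rewrite /hexp.
  case: ifP => s0; last by rewrite !mul0r.
  by rewrite corrE// inner_semigroup_resolvent.
- exact: measurable_correlation.
- by move=> t; exact: correlation_bounded.
Qed.

End resolvent_L2.

(** * The telescoping sum *)

(** With l the vanishing parameter, m = mu_k and, in the notation of the
    statement, a = <f_(k-1)^*, G_l f_(k-1)>, e = <f_(k-1)^*, G_l f_k> and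
    b = <f_k^*, G_l f_k>, the first two equations are the resolvent equations
    for f_(k-1) and f_k, both tested against f_(k-1)^*. *)
Lemma two_resolvent_equations (K : fieldType) (m l a b p q e x y z w : K) :
  m != 0 -> (m - l) * y = a - x -> (l - m) * w = z - e ->
  p = m * x -> e = m * y -> q = m * z -> b = m * w ->
  a = m^-1 * p + (1 - l / m) * (m^-1 * q + (1 - l / m) * b).
Proof.
move=> m0 Ha He -> ey -> ->.
have -> : a = x + (m - l) * y by rewrite Ha addrC subrK.
have -> : y = m^-1 * (z - (l - m) * w) by rewrite He opprB addrC subrK ey mulKf.
by field.
Qed.

Section telescoping.
Context (R : realType) (T : pmetricType R) (d : measure_display)
  (Omega : measurableType d) (X : R -> Omega -> borel T)
  (Pr : borel T -> probability Omega R) (P : probability (borel T) R).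
Hypotheses (hX : feller_process X Pr) (hP : invariant_law X Pr P).
Variables (f : T -> R) (mu : nat -> R).
Hypotheses (hf : f \in Lfun P 2%:E) (hmu : forall k, 0 < mu k <= 1).
Hypothesis hint : (\int[lebesgue_measure]_(t in `[0%R, +oo[)
  `|inner P f (semigroup X Pr t f)|%:E < +oo)%E.
Local Notation leb := (@lebesgue_measure R).

Let S := semigroup X Pr.
Let G := resolvent X Pr P.
Let Gs := resolvent_adj X Pr P.
Let corr := correlation X Pr P.
Variables F Fs : nat -> T -> R.
Hypotheses (F0 : F 0%N = f) (Fs0 : Fs 0%N = f).
Hypothesis FS : forall k, F k.+1 = fun x => mu k * G (mu k) (F k) x.
Hypothesis FsS : forall k, Fs k.+1 = fun x => mu k * Gs (mu k) (Fs k) x.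

Let mu_gt0 k : 0 < mu k. Proof. by have /andP[] := hmu k. Qed.

Let F_L2 k : F k \in Lfun P 2%:E.
Proof.
elim: k => [|k IH]; [by rewrite F0|rewrite FS; apply: L2Z].
by have [] := resolventP hX hP (mu_gt0 k) IH.
Qed.

Let Fs_L2 k : Fs k \in Lfun P 2%:E.
Proof.
elim: k => [|k IH]; [by rewrite Fs0|rewrite FsS; apply: L2Z].
by have [] := resolvent_adjP hX hP (mu_gt0 k) IH.
Qed.

Let G_L2 l g : 0 < l -> g \in Lfun P 2%:E -> G l g \in Lfun P 2%:E.
Proof. by move=> l0 gL; have [] := resolventP hX hP l0 gL. Qed.

Let Gs_L2 l g : 0 < l -> g \in Lfun P 2%:E ->
  Gs l g \in Lfun P 2%:E.
Proof. by move=> l0 gL; have [] := resolvent_adjP hX hP l0 gL. Qed.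

Let inner_FS k g : g \in Lfun P 2%:E ->
  inner P g (F k.+1) = mu k * inner P g (G (mu k) (F k)).
Proof.
move=> gL; have GL := G_L2 (mu_gt0 k) (F_L2 k).
by rewrite FS; exact: (innerZr (mu k) gL GL).
Qed.

Let inner_FsS k g : g \in Lfun P 2%:E ->
  inner P (Fs k.+1) g = mu k * inner P (Gs (mu k) (Fs k)) g.
Proof.
move=> gL; have GL := Gs_L2 (mu_gt0 k) (Fs_L2 k).
by rewrite FsS; exact: (innerZl (mu k) GL gL).
Qed.

Let corr_forward k s : 0 <= s -> corr (Fs k) (F k.+1) s =
  mu k * \int[leb]_t (hexp (mu k) t * corr (Fs k) (F k) (s + t)).
Proof.
move=> s0; have GL := G_L2 (mu_gt0 k) (F_L2 k).
rewrite -(inner_semigroup_resolvent hX hP (mu_gt0 k) s0 (Fs_L2 k) (F_L2 k)).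
rewrite FS /corr /correlation max_l//.
exact: (semigroupZ hX hP (mu k) s0 (Fs_L2 k) GL).
Qed.

Let corr_backward k s : 0 <= s -> corr (Fs k.+1) (F k.+1) s =
  mu k * \int[leb]_t (hexp (mu k) t * corr (Fs k) (F k.+1) (s + t)).
Proof.
move=> s0.
rewrite -(inner_resolvent_adj_semigroup hX hP (mu_gt0 k) s0 (Fs_L2 k) (F_L2 k.+1)).
rewrite /corr /correlation max_l//; apply: inner_FsS.
exact: (semigroup_L2 hX hP s0 (F_L2 k.+1)).
Qed.

Let mcorr g h : g \in Lfun P 2%:E -> h \in Lfun P 2%:E ->
  measurable_fun setT (corr g h).
Proof. by move=> gL hL; exact: measurable_correlation. Qed.

(** Each index costs two exponential averages, one for each sequence. *)
Let damped_corr_le j n :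
  (\int[leb]_t (damp j t * `|corr (Fs n) (F n) t|)%:E <=
   \int[leb]_t (damp (j + n.*2) t * `|corr f f t|)%:E)%E.
Proof.
elim: n j => [|n IH] j; first by rewrite F0 Fs0 addn0.
apply: (le_trans (damp_average j (hmu n) (mcorr (Fs_L2 n) (F_L2 n.+1))
  (mcorr (Fs_L2 n.+1) (F_L2 n.+1)) (corr_backward n))).
apply: (le_trans (damp_average j.+1 (hmu n) (mcorr (Fs_L2 n) (F_L2 n))
  (mcorr (Fs_L2 n) (F_L2 n.+1)) (corr_forward n))).
by apply: (le_trans (IH j.+2)); rewrite doubleS !addnS !addSn.
Qed.

Let a n l := inner P (Fs n) (G l (F n)).

Let aE n l : 0 < l -> a n l = \int[leb]_t (hexp l t * corr (Fs n) (F n) t).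
Proof. by move=> l0; have [_ GE] := resolventP hX hP l0 (F_L2 n); exact: GE. Qed.

Let a_step n l : 0 < l < mu n ->
  a n l = (mu n)^-1 * inner P (Fs n) (F n.+1) + (1 - l / mu n) *
    ((mu n)^-1 * inner P (Fs n.+1) (F n.+1) + (1 - l / mu n) * a n.+1 l).
Proof.
move=> /andP[l0 lmu]; have m0 := mu_gt0 n; have mn0 : mu n != 0 by rewrite gt_eqF.
have lm : l != mu n by rewrite lt_eqF.
have FL := F_L2 n; have FsL := Fs_L2 n.
have GL := G_L2 m0 FL; have GsL := Gs_L2 m0 FsL; have F1L := F_L2 n.+1.
have H1 := resolvent_identity hX hP l0 m0 lm FsL FL.
have GlF1L := G_L2 l0 F1L.
have ml : mu n != l by rewrite eq_sym.
have H2 := resolvent_identity hX hP m0 l0 ml FsL F1L.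
have [_ GsE] := resolvent_adjP hX hP m0 FsL.
have e1 := inner_FS n FsL.
have e2 : inner P (Fs n) (G l (F n.+1)) = mu n * inner P (Fs n) (G l (G (mu n) (F n))).
  by rewrite FS; exact: (resolventZ hX hP (mu n) l0 FsL GL).
have e3 : inner P (Fs n.+1) (F n.+1) = mu n * inner P (Fs n) (G (mu n) (F n.+1)).
  exact: (etrans (inner_FsS n F1L) (congr1 ( *%R (mu n)) (GsE _ F1L))).
have e4 : a n.+1 l = mu n * inner P (Fs n) (G (mu n) (G l (F n.+1))).
  exact: (etrans (inner_FsS n GlF1L) (congr1 ( *%R (mu n)) (GsE _ GlF1L))).
exact: (two_resolvent_equations mn0 H1 H2 e1 e2 e3 e4).
Qed.

Let int_corr_fin : (\int[leb]_t (hexp 0 t * `|corr f f t|)%:E < +oo)%E.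
Proof.
move: hint; rewrite integral_mkcond; congr (_ < _)%E; apply: eq_integral => t _.
rewrite patchE mem_setE in_itv/= andbT /hexp mul0r oppr0 expR0.
case: ifP => t0; last by rewrite mul0r.
by rewrite mul1r /corr /correlation max_l.
Qed.

(** Abelian limit of the Laplace transform of an integrable function. *)
Let a0_cvg : a 0 l @[l --> 0^'+] --> \int[leb]_t (hexp 0 t * corr f f t).
Proof.
apply/cvg_at_rightP => u [u0 u_0].
rewrite (_ : (fun n => a 0 (u n)) =
    fun n => fine (\int[leb]_t (hexp (u n) t * corr f f t)%:E)); last first.
  by apply/funext => n; rewrite aE// F0 Fs0.
have mc := mcorr hf hf.
have mh l : measurable_fun setT (fun t => (hexp l t * corr f f t)%:E).
  by apply/measurable_EFinP/measurable_funM => //; exact: measurable_hexp.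
have ih0 : leb.-integrable setT (fun t => (hexp 0 t * `|corr f f t|)%:E).
  apply/integrableP; split.
    apply/measurable_EFinP/measurable_funM; first exact: measurable_hexp.
    exact: measurableT_comp.
  under eq_integral do rewrite gee0_abs ?lee_fin ?mulr_ge0 ?hexp_ge0//.
  exact: int_corr_fin.
apply: fine_cvg; rewrite fineK; last first.
  apply: integrable_fin_num => //; apply: le_integrable ih0 => //.
    exact: mh.
  by move=> t _; rewrite /= lee_fin !normrM normr_id.
apply: (@dominated_cvg _ _ _ leb _ measurableT
  (fun n t => (hexp (u n) t * corr f f t)%:E) _ _ _ _ _ ih0) => //.
- by move=> n; exact: mh.
- move=> t _; apply: cvg_EFin; first exact: nearW.
  apply: cvgMl; rewrite /hexp; case: ifP => t0; last exact: cvg_cst.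
  apply: continuous_cvg; first exact: continuous_expR.
  by apply: cvgN; apply: cvgMl.
- move=> n t _; rewrite /= lee_fin normrM (ger0_norm (hexp_ge0 _ _)).
  rewrite ler_wpM2r// /hexp; case: ifP => // t0.
  by rewrite ler_expR lerN2 mul0r mulr_ge0// ltW.
Qed.

(** For small l the step can be solved for the next term, since 1 - l / mu_n is
    then invertible and tends to 1. *)
Let a_cvg_step n L : a n l @[l --> 0^'+] --> L -> a n.+1 l @[l --> 0^'+] -->
  L - (mu n)^-1 * (inner P (Fs n) (F n.+1) + inner P (Fs n.+1) (F n.+1)).
Proof.
move=> aL; set p := inner P (Fs n) (F n.+1); set q := inner P (Fs n.+1) (F n.+1).
have m0 := mu_gt0 n; pose c l := 1 - l / mu n.
have c1 : (c l)^-1 @[l --> 0^'+] --> (1 : R).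
  rewrite -[X in _ --> X]invr1; apply: cvgV; first exact: oner_neq0.
  rewrite -[X in _ --> X]subr0 /c; apply: cvgB; first exact: cvg_cst.
  rewrite -[X in _ --> X](mul0r (mu n)^-1); apply: cvgMl.
  exact: cvg_within.
have cv : (c l)^-1 * ((c l)^-1 * (a n l - (mu n)^-1 * p) - (mu n)^-1 * q)
    @[l --> 0^'+] --> 1 * (1 * (L - (mu n)^-1 * p) - (mu n)^-1 * q).
  apply: cvgM => //; apply: cvgB; last exact: cvg_cst.
  by apply: cvgM => //; apply: cvgB => //; exact: cvg_cst.
rewrite (_ : L - _ = 1 * (1 * (L - (mu n)^-1 * p) - (mu n)^-1 * q)); last by ring.
apply: cvg_trans cv; apply: near_eq_cvg; near=> l.
have l0 : 0 < l by near: l; exact: nbhs_right_gt.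
have lm : l < mu n by near: l; exact: nbhs_right_lt.
have c0 : c l != 0 by rewrite /c subr_eq0 eq_sym lt_eqF// ltr_pdivrMr// mul1r.
rewrite (@a_step n l) ?l0// -/p -/q -/(c l).
move: (a n.+1 l) (c l) c0 => y z z0.
by rewrite addrAC subrr add0r mulKf// addrAC subrr add0r mulKf.
Unshelve. all: by end_near. Qed.

Let limit n := \int[leb]_t (hexp 0 t * corr f f t) - \sum_(0 <= k < n)
  (mu k)^-1 * (inner P (Fs k) (F k.+1) + inner P (Fs k.+1) (F k.+1)).

Let a_cvg n : a n l @[l --> 0^'+] --> limit n.
Proof.
elim: n => [|n IH].
  by rewrite /limit big_geq// subr0; exact: a0_cvg.
by rewrite /limit big_nat_recr//= opprD addrA; exact: a_cvg_step.
Qed.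

Let inv_formE n : inv_form X Pr P (Fs n) (F n) = limit n.
Proof. by have /cvg_lim := @a_cvg n; apply. Qed.

Let bound n := (\int[leb]_t (damp n t * `|corr f f t|)%:E)%E.

Let measurable_bound n :
  measurable_fun setT (fun t => (damp n t * `|corr f f t|)%:E).
Proof.
apply/measurable_EFinP/measurable_funM; first exact: measurable_damp.
exact: (measurableT_comp _ (mcorr hf hf)).
Qed.

Let bound_fin n : bound n \is a fin_num.
Proof.
rewrite ge0_fin_numE; last first.
  by apply: integral_ge0 => t _; rewrite lee_fin mulr_ge0 ?damp_ge0.
apply: le_lt_trans int_corr_fin; apply: ge0_le_integral => //.
- by move=> t _; rewrite lee_fin mulr_ge0 ?damp_ge0.
- exact: measurable_bound.
- apply/measurable_EFinP/measurable_funM; first exact: measurable_hexp.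
  exact: (measurableT_comp _ (mcorr hf hf)).
- by move=> t _; rewrite lee_fin ler_wpM2r// damp_le_hexp.
Qed.

Let a_le n l : 0 < l -> (`|a n l|%:E <= bound n)%E.
Proof.
move=> l0; rewrite aE//; have mc := mcorr (Fs_L2 n) (F_L2 n).
have mh : measurable_fun setT (fun t => (hexp l t * corr (Fs n) (F n) t)%:E).
  by apply/measurable_EFinP/measurable_funM => //; exact: measurable_hexp.
apply: (@le_trans _ _ `|\int[leb]_t (hexp l t * corr (Fs n) (F n) t)%:E|%E).
  by rewrite /Rintegral; case: (\int[leb]_t _)%E => [r| |] //=; rewrite normr0 leey.
apply: (le_trans (le_abse_integral leb measurableT mh)).
apply: (@le_trans _ _ (\int[leb]_t (damp 0 t * `|corr (Fs n) (F n) t|)%:E)%E).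
  apply: ge0_le_integral => //.
  - by apply: measurableT_comp mh.
  - apply/measurable_EFinP/measurable_funM; first exact: measurable_damp.
    exact: measurableT_comp.
  - move=> t _; rewrite /= lee_fin normrM (ger0_norm (hexp_ge0 _ _)) ler_wpM2r//.
    rewrite damp0 /hexp; case: ifP => // t0.
    by rewrite ler_expR lerN2 mul0r mulr_ge0// ltW.
apply: (le_trans (damped_corr_le 0 n)).
apply: ge0_le_integral => //.
- by move=> t _; rewrite lee_fin mulr_ge0 ?damp_ge0.
- exact: measurable_bound.
- exact: measurable_bound.
- by move=> t _; rewrite lee_fin ler_wpM2r// damp_le// add0n -addnn leq_addr.
Qed.

Let limit_le n : `|limit n| <= fine (bound n).
Proof.
have c : `|a n l| @[l --> 0^'+] --> `|limit n| by apply: cvg_norm; exact: (@a_cvg n).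
rewrite -(cvg_lim _ c)//; apply: limr_le; first by apply/cvg_ex; exists `|limit n|.
near=> l; have l0 : 0 < l by near: l; exact: nbhs_right_gt.
by rewrite -lee_fin fineK ?bound_fin//; exact: a_le.
Unshelve. all: by end_near. Qed.

Lemma inv_form_telescope :
  [/\ forall n : nat, inv_form_defined X Pr P (Fs n.+1) (F n.+1),
      inv_form X Pr P (Fs n.+1) (F n.+1) @[n --> \oo] --> (0 : R),
      inv_form_defined X Pr P f f &
      forall n : nat,
        inv_form X Pr P f f =
          \sum_(0 <= k < n.+1)
            (mu k)^-1 * (inner P (Fs k) (F k.+1) + inner P (Fs k.+1) (F k.+1))
          + inv_form X Pr P (Fs n.+1) (F n.+1)].
Proof.
split.
- by move=> n; apply/cvg_ex; exists (limit n.+1); exact: (@a_cvg n.+1).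
- rewrite (cvg_shiftS (fun n => inv_form X Pr P (Fs n) (F n))).
  apply/cvgr0Pnorm_le => e e0.
  have /fine_cvg/cvgr0Pnorm_le/(_ e e0) := damp_cvg0 (mcorr hf hf) int_corr_fin.
  apply: filterS => n /= ne; rewrite inv_formE (le_trans (limit_le n))//.
  exact: le_trans (ler_norm _) ne.
- by have := @a_cvg 0; rewrite /a F0 Fs0 => c; apply/cvg_ex; exists (limit 0).
- move=> n; rewrite inv_formE -{1}Fs0 -F0 inv_formE.
  by rewrite /limit big_geq// subr0 addrC subrK.
Qed.

End telescoping.

Theorem theorem5p1 (R : realType) (T : pmetricType R)
    (d : measure_display) (Omega : measurableType d)
    (X : R -> Omega -> borel T) (Pr : borel T -> probability Omega R)
    (P : probability (borel T) R)
    (hX : feller_process X Pr) (hP : invariant_law X Pr P)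
    (f : T -> R) (hf : f \in Lfun P 2%:E) (hf0 : ('E_P[f] = 0)%E)
    (hint : (\int[lebesgue_measure]_(t in `[0%R, +oo[)
               `|inner P f (semigroup X Pr t f)|%:E < +oo)%E)
    (mu : nat -> R) (hmu : forall k, 0 < mu k <= 1) :
  let F (k : nat) := fseq X Pr P f mu k in
  let Fs (k : nat) := fseq_adj X Pr P f mu k in
  [/\ forall n : nat, inv_form_defined X Pr P (Fs n.+1) (F n.+1),
      inv_form X Pr P (Fs n.+1) (F n.+1) @[n --> \oo] --> (0 : R),
      inv_form_defined X Pr P f f &
      forall n : nat,
        inv_form X Pr P f f =
          \sum_(0 <= k < n.+1)
            (mu k)^-1 * (inner P (Fs k) (F k.+1) + inner P (Fs k.+1) (F k.+1))
          + inv_form X Pr P (Fs n.+1) (F n.+1)].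
Proof.
move=> F Fs.
by apply: (inv_form_telescope hX hP hf hmu hint (F := F) (Fs := Fs)).
Qed.
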